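(* Let $\mathcal{A}=\mathrm{NH}_{k,\hbar=0}$ and let $\nu\in\mathrm{MC}(\mathrm{HC}(\mathcal{A}),\mathbb{C}[[\hbar]]_{(0,1)})_0$ be a $\mathbb{Z}^2$-graded deformation of $\mathcal{A}$ over $\mathbb{C}[[\hbar]]_{(0,1)}$. Assume that $\nu$ is a nontrivial deformation. Then there exists a $\mathbb{Z}^2$-homogeneous $A_\infty$-isomorphism $F:(\mathcal{A}[[\hbar]],\mu+\nu)\to\mathrm{NH}_k$ (linear over the base field $\mathbb{C}$, not necessarily over $\mathbb{C}[[\hbar]]$).
   Context: For $k\ge1$, $\mathcal{A}=\mathrm{NH}_{k,\hbar=0}$ is the $\mathbb{C}$-algebra generated by $X_1,\dots,X_k,\sigma_1,\dots,\sigma_{k-1}$ with relations $X_iX_j=X_jX_i$; $\sigma_iX_i=X_{i+1}\sigma_i$; $\sigma_iX_{i+1}=X_i\sigma_i$; $\sigma_iX_j=X_j\sigma_i$ for $j\ne i,i+1$; $\sigma_i^2=0$; $\sigma_i\sigma_{i+1}\sigma_i=\sigma_{i+1}\sigma_i\sigma_{i+1}$; $\sigma_i\sigma_j=\sigma_j\sigma_i$ for $|i-j|\ge2$. It has $\mathbb{C}$-basis $X^a\sigma_w$ ($a\in\mathbb{N}^k$, $w\in S_k$, $\sigma_w$ the product along any reduced word). It is $\mathbb{Z}^2$-graded by $\deg X_i=(-1,0)$, $\deg\sigma_i=(1,1)$ and viewed as an $A_\infty$-algebra concentrated in cohomological degree $0$; its product is denoted $\mu$. $\mathrm{NH}_k$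 is the $\mathbb{C}[[\hbar]]$-algebra with the same generators and relations except $\sigma_iX_i=X_{i+1}\sigma_i+\hbar$ and $\sigma_iX_{i+1}=X_i\sigma_i-\hbar$, with underlying module $\mathcal{A}[[\hbar]]$ via the basis $X^a\sigma_w$. $\mathbb{C}[[\hbar]]_{(0,1)}$ denotes $\mathbb{C}[[\hbar]]$ with $\deg\hbar=(0,1)$ (gradings on all quotients $\mathbb{C}[\hbar]/\hbar^n$). $\mathrm{HC}(\mathcal{A})$ is the Hochschild DGLA with $\mathrm{HC}^n=\mathrm{Hom}_{\mathbb{C}}(\mathcal{A}^{\otimes(n+1)},\mathcal{A})$, $n\ge-1$. An element of $\mathrm{MC}(\mathrm{HC}(\mathcal{A}),\mathbb{C}[[\hbar]]_{(0,1)})_0$ is a bilinear map $\nu:\mathcal{A}\times\mathcal{A}\to\hbar\mathcal{A}[[\hbar]]$, extended $\mathbb{C}[[\hbar]]$-bilinearly, such that $\mu+\nu$ is associative on $\mathcal{A}[[\hbar]]$ and $\nu$ is homogeneous of degree $0$: for $a,b$ homogeneous, the $\hbar^n$-coefficient of $\nu(a,b)$ lies in degree $\deg a+\deg b-(0,n)$. Two such $\nu,\nu'$ are $\mathbb{Z}^2$-graded gauge equivalent if there is a $\mathbb{C}[[\hbar]]$-linear degree-$0$ homogeneous algebra isomorphism $(\mathcal{A}[[\hbar]],\mu+\nu)\to(\mathcal{A}[[\hbar]],\mu+\nu')$ equal to the identity modulo $\hbar$. $\nu$ is nontrivial if it is not $\mathbb{Z}^2$-graded gauge equivalent to $0$.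 A map $\mathcal{A}[[\hbar]]\to\mathcal{A}[[\hbar]]$ is $\mathbb{Z}^2$-homogeneous if it induces, on each quotient by $\hbar^n$, a map homogeneous of degree $0$. $A_\infty$-isomorphism means an $A_\infty$-functor whose first component is bijective. *)

(* Defs.v *)
(* The complex numbers are R[i], for R : realType. *)
From mathcomp Require Export all_boot fingroup perm all_algebra complex.
From mathcomp Require Export boolp functions reals.
From mathcomp Require Import zify.

Set Implicit Arguments.
Unset Strict Implicit.
Unset Printing Implicit Defensive.

Import GRing.Theory.
Local Open Scope ring_scope.

(** * A-infinity algebras and functors

    A graded vector space is a K-module V with a predicate [deg p v], "v lies
    in the summand of degree p".  The operations of all arities are bundled
    into one function on sequences, [m [:: a_1; ...; a_d]] being m_d(a_1, ...,
    a_d).  Signs are those of the bar construction: with |a|' = |a| - 1,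
      sum_(r, l) (-1)^(|a_1|' + ... + |a_r|')
         m(a_1, ..., a_r, m(a_(r+1), ..., a_(r+l)), ..., a_d) = 0. *)

Section AInfinity.
Context {K : fieldType}.

Definition multilinear {V W : lmodType K} (F : seq V -> W) : Prop :=
  forall (s t : seq V) (c : K) (x y : V),
    F (s ++ (c *: x + y) :: t) = c *: F (s ++ x :: t) + F (s ++ y :: t).

Definition has_degrees {V : Type} (deg : int -> V -> Prop)
    (ds : seq int) (s : seq V) : Prop :=
  size ds = size s /\
  forall x0 i, (i < size s)%N -> deg (nth 0 ds i) (nth x0 s i).

(* [F] restricted to sequences of length d has degree e - d. *)
Definition of_degree {V W : Type} (degV : int -> V -> Prop)
    (degW : int -> W -> Prop) (e : int) (F : seq V -> W) : Prop :=
  forall ds s, has_degrees degV ds s ->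
    degW (\sum_(p <- ds) p + e - (size s)%:Z) (F s).

Definition insertions {V W : lmodType K} (ds : seq int)
    (F : seq V -> W) (m : seq V -> V) (s : seq V) : W :=
  \sum_(r < size s) \sum_(1 <= l < (size s - r).+1)
    (-1) ^ (\sum_(p <- take r ds) (p - 1)) *:
      F (take r s ++ m (take l (drop r s)) :: drop (r + l) s).

Record ainf_algebra {V : lmodType K} (deg : int -> V -> Prop)
    (m : seq V -> V) : Prop := AinfAlgebra {
  ainf_uncurved : m [::] = 0;
  ainf_multilinear : multilinear m;
  ainf_degree : of_degree deg deg 2 m;
  ainf_relations : forall ds s, has_degrees deg ds s -> insertions ds m m s = 0
}.

(* All the ways of cutting s into consecutive nonempty blocks. *)
Fixpoint blocks {T : Type} (s : seq T) : seq (seq (seq T)) :=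
  if s is x :: s' then
    flatten [seq ([:: x] :: p) :: (if p is b :: p' then [:: (x :: b) :: p']
                                   else [::]) | p <- blocks s']
  else [:: [::]].

Record ainf_functor {V W : lmodType K}
    (degV : int -> V -> Prop) (mV : seq V -> V)
    (degW : int -> W -> Prop) (mW : seq W -> W) (F : seq V -> W) : Prop :=
  AinfFunctor {
  ainf_functor_nil : F [::] = 0;
  ainf_functor_multilinear : multilinear F;
  ainf_functor_degree : of_degree degV degW 1 F;
  ainf_functor_relations : forall ds s, has_degrees degV ds s ->
    \sum_(p <- blocks s) mW [seq F b | b <- p] = insertions ds F mV s
}.

Definition ainf_iso {V W : lmodType K}
    (degV : int -> V -> Prop) (mV : seq V -> V)
    (degW : int -> W -> Prop) (mW : seq W -> W) (F : seq V -> W) : Prop :=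
  ainf_functor degV mV degW mW F /\ bijective (fun v : V => F [:: v]).

(* An associative algebra as an A-infinity algebra concentrated in degree 0. *)
Definition deg0 {V : lmodType K} (p : int) (v : V) : Prop := p = 0 \/ v = 0.

Definition assoc_ops {V : lmodType K} (mul : V -> V -> V) (s : seq V) : V :=
  if s is [:: a; b] then mul a b else 0.

Lemma assoc_ainf_algebra (V : lmodType K) (mul : V -> V -> V) :
  (forall c x y z, mul (c *: x + y) z = c *: mul x z + mul y z) ->
  (forall c x y z, mul z (c *: x + y) = c *: mul z x + mul z y) ->
  associative mul -> ainf_algebra deg0 (assoc_ops mul).
Proof.
move=> mull mulr mulA.
have mul0l x : mul 0 x = 0.
  by have := mull (-1) 0 0 x; rewrite scaler0 addr0 scaleN1r addNr.
have mul0r x : mul x 0 = 0.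
  by have := mulr (-1) 0 0 x; rewrite scaler0 addr0 scaleN1r addNr.
have ops0 s : size s != 2%N -> assoc_ops mul s = 0 by case: s => [|? [|? []]].
have opsz s t : assoc_ops mul (s ++ 0 :: t) = 0.
  case: s => [|? [|? [|? ?]]] //=; case: t => [|? [|? ?]] //=.
split=> //.
- move=> s t c x y; case: s => [|a [|b [|d s]]] /=.
  + by case: t => [|b [|d t]] //=; rewrite scaler0 addr0.
  + by case: t => [|b t] //=; rewrite scaler0 addr0.
  + by rewrite scaler0 addr0.
  + by rewrite scaler0 addr0.
- move=> ds [|a [|b [|d s]]] [sz H]; try by right.
  case: ds sz H => [|p [|q [|r ds]]] //= _ H.
  case: (H a 0%N isT) => /= [->|->]; last by right.
  case: (H a 1%N isT) => /= [->|->]; last by right; rewrite mul0r.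
  by left; rewrite !big_cons big_nil.
- move=> ds [|a [|b [|c [|d s]]]] [sz H]; rewrite /insertions.
  + by rewrite big_ord0.
  + by rewrite big_ord1 subn0 big_nat1 /= scaler0.
  + rewrite !big_ord_recl big_ord0 /=.
    rewrite subn0 big_nat_recl // big_nat1 /= subSS subn0 big_nat1 /=.
    by rewrite ?mul0l ?mul0r !scaler0 !addr0.
  + case: ds sz H => [|p [|q [|r [|? ds]]]] //= _ H.
    rewrite !big_ord_recl big_ord0 /= !subSS !subn0 /index_iota unlock /=.
    rewrite !(scaler0, addr0, add0r) expr0z scale1r.
    case: (H a 0%N isT) => /= [->|->]; last by rewrite !mul0l scaler0 addr0.
    by rewrite add0r exprN1 invrN1 scaleN1r mulA subrr.
  + apply: big1 => r _; apply: big1_seq => l /andP[_].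
    rewrite mem_index_iota => /andP[l_gt0 lr].
    set z := _ ++ _; suff -> : assoc_ops mul z = 0 by rewrite scaler0.
    rewrite {}/z; set s4 := [:: a, b, c, d & s] in r lr *.
    have lds : (l <= size (drop r s4))%N by rewrite size_drop -ltnS.
    have [l2|l2] := eqVneq l 2%N; last first.
      by rewrite (ops0 (take l _)) ?opsz // size_takel.
    apply: ops0; rewrite size_cat /= size_drop size_takel 1?ltnW //.
    by rewrite l2 subnDA addnS -subnDA subnDA; move: lds; rewrite size_drop l2 /=; lia.
Qed.

End AInfinity.

(** * Formal power series: the element sum_n f_n hbar^n of A[[hbar]] is the
    function f : nat -> A, and C[[hbar]] is nat -> C. *)

Notation pser A := (nat -> A).

Section PowerSeries.
Context {C : fieldType} {A : algType C}.

Definition hconst (a : A) : pser A := fun n => if n == 0%N then a else 0.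

Definition hvar : pser A := fun n => if n == 1%N then 1 else 0.

Definition hscale (c : pser C) (f : pser A) : pser A :=
  fun n => \sum_(i < n.+1) c i *: f (n - i)%N.

Definition hlinear (phi : pser A -> pser A) : Prop :=
  (forall f g, phi (f + g) = phi f + phi g) /\
  (forall c f, phi (hscale c f) = hscale c (phi f)).

(* The C[[hbar]]-bilinear extension to A[[hbar]] of a bilinear map on A. *)
Definition hextend (B : A -> A -> pser A) (f g : pser A) : pser A :=
  fun n => \sum_(i < n.+1) \sum_(j < (n - i).+1) B (f i) (g j) (n - i - j)%N.

(* mu + nu *)
Definition star (nu : A -> A -> pser A) : pser A -> pser A -> pser A :=
  hextend (fun a b => hconst (a * b) + nu a b).

Definition hcongr (n : nat) (f g : pser A) : Prop :=
  forall i, (i < n)%N -> f i = g i.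

End PowerSeries.

(** * The nilHecke algebra and its degeneration *)

Section NilHecke.
Context {k : nat}.

(* Generators: [inl i] is X_(i+1) and [inr i] is sigma_(i+1). *)
Definition gen : finType := ('I_k + 'I_k.-1)%type.

(* The two indices moved by sigma_i; [ordS] is the cyclic successor, which does
   not wrap around here because i < k.-1. *)
Definition lo (i : 'I_k.-1) : 'I_k := widen_ord (leq_pred k) i.
Definition hi (i : 'I_k.-1) : 'I_k := ordS (lo i).

(* The defining relations, for a product [mul] on V and a parameter [h] in V:
   h = 0 for the degenerate algebra, h = hbar for the nilHecke algebra. *)
Record nh_relations {V : zmodType} (mul : V -> V -> V) (h : V)
    (X : 'I_k -> V) (sigma : 'I_k.-1 -> V) : Prop := NhRelations {
  nh_XX : forall i j, mul (X i) (X j) = mul (X j) (X i);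
  nh_sX_lo : forall i,
    mul (sigma i) (X (lo i)) = mul (X (hi i)) (sigma i) + h;
  nh_sX_hi : forall i,
    mul (sigma i) (X (hi i)) = mul (X (lo i)) (sigma i) - h;
  nh_sX_far : forall i j, j != lo i -> j != hi i ->
    mul (sigma i) (X j) = mul (X j) (sigma i);
  nh_ss : forall i, mul (sigma i) (sigma i) = 0;
  nh_braid : forall i j : 'I_k.-1, j = i.+1 :> nat ->
    mul (mul (sigma i) (sigma j)) (sigma i) =
    mul (mul (sigma j) (sigma i)) (sigma j);
  nh_s_far : forall i j : 'I_k.-1, (i.+1 < j)%N ->
    mul (sigma i) (sigma j) = mul (sigma j) (sigma i)
}.

Definition word_prod {V : Type} (mul : V -> V -> V) (one : V)
    (X : 'I_k -> V) (sigma : 'I_k.-1 -> V) (w : seq gen) : V :=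
  foldr mul one [seq (match g with inl i => X i | inr i => sigma i end) | g <- w].

Definition gen_degree (g : gen) : int * int :=
  match g with inl _ => (-1, 0) | inr _ => (1, 1) end.

Definition word_degree (w : seq gen) : int * int := \sum_(g <- w) gen_degree g.

Definition word_perm (w : seq 'I_k.-1) : 'S_k :=
  (\prod_(i <- w) tperm (lo i) (hi i))%g.

Definition reduced (w : seq 'I_k.-1) : Prop :=
  forall w', word_perm w' = word_perm w -> (size w <= size w')%N.

(* X_1^(a_1) ... X_k^(a_k) sigma_(w_1) ... sigma_(w_l) *)
Definition basis_word (a : 'I_k -> nat) (w : seq 'I_k.-1) : seq gen :=
  flatten [seq nseq (a i) (inl i) | i <- enum 'I_k] ++ [seq inr i | i <- w].

Context {C : fieldType} {A : algType C}.
Variables (X : 'I_k -> A) (sigma : 'I_k.-1 -> A).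

(* A is the C-algebra presented by the generators X, sigma and the relations
   at hbar = 0. *)
Definition is_nh0 : Prop :=
  nh_relations *%R 0 X sigma /\
  forall (B : algType C) (X' : 'I_k -> B) (sigma' : 'I_k.-1 -> B),
    nh_relations *%R 0 X' sigma' ->
    exists f : {lrmorphism A -> B},
      [/\ forall i, f (X i) = X' i, forall i, f (sigma i) = sigma' i &
          forall g : {lrmorphism A -> B},
            (forall i, g (X i) = X' i) -> (forall i, g (sigma i) = sigma' i) ->
            g =1 f].

(* The grading of A: combinations of words of degree d in the generators. *)
Definition homog (d : int * int) (a : A) : Prop :=
  exists s : seq (C * seq gen),
    (forall p, p \in s -> word_degree p.2 = d) /\
    a = \sum_(p <- s) p.1 *: word_prod *%R 1 X sigma p.2.

(* Homogeneous elements of A[[hbar]]/hbar^n, with deg hbar = (0, 1). *)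
Definition hhomog (n : nat) (d : int * int) (f : pser A) : Prop :=
  forall i, (i < n)%N -> homog (d - (0, i%:Z)) (f i).

(* [F], on sequences of each length, induces on the quotients by hbar^n maps
   homogeneous of degree 0. *)
Definition Z2_homogeneous_multi (F : seq (pser A) -> pser A) : Prop :=
  forall n : nat,
    (forall s t, size s = size t ->
       (forall i, (i < size s)%N -> hcongr n (nth 0 s i) (nth 0 t i)) ->
       hcongr n (F s) (F t)) /\
    (forall (ds : seq (int * int)) s, size ds = size s ->
       (forall i, (i < size s)%N -> hhomog n (nth 0 ds i) (nth 0 s i)) ->
       hhomog n (\sum_(d <- ds) d) (F s)).

Definition Z2_homogeneous (phi : pser A -> pser A) : Prop :=
  forall n : nat,
    (forall f g, hcongr n f g -> hcongr n (phi f) (phi g)) /\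
    (forall d f, hhomog n d f -> hhomog n d (phi f)).

(* [nh] is the product of NH_k on the module A[[hbar]]: a C[[hbar]]-algebra
   structure satisfying the relations with parameter hbar, in which every
   X^a sigma_w, computed along any reduced word, is the element X^a sigma_w of
   A.  This determines [nh], as the X^a sigma_w form a basis of A. *)
Record is_nh (nh : pser A -> pser A -> pser A) : Prop := IsNh {
  is_nh_linear_l : forall g, hlinear (fun f => nh f g);
  is_nh_linear_r : forall f, hlinear (nh f);
  is_nh_assoc : forall f g h, nh f (nh g h) = nh (nh f g) h;
  is_nh_one_l : forall f, nh (hconst 1) f = f;
  is_nh_one_r : forall f, nh f (hconst 1) = f;
  is_nh_relations :
    nh_relations nh hvar (fun i => hconst (X i)) (fun i => hconst (sigma i));
  is_nh_basis : forall a w, reduced w ->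
    word_prod nh (hconst 1) (fun i => hconst (X i)) (fun i => hconst (sigma i))
      (basis_word a w) =
    hconst (word_prod *%R 1 X sigma (basis_word a w))
}.

(* MC(HC(A), C[[hbar]]_(0,1))_0 *)
Record graded_MC (nu : A -> A -> pser A) : Prop := GradedMC {
  MC_linear_l : forall c a a' b, nu (c *: a + a') b = c *: nu a b + nu a' b;
  MC_linear_r : forall c a b b', nu a (c *: b + b') = c *: nu a b + nu a b';
  MC_positive : forall a b, nu a b 0%N = 0;
  MC_assoc : forall f g h,
    star nu f (star nu g h) = star nu (star nu f g) h;
  MC_degree : forall d e a b n, homog d a -> homog e b ->
    homog (d + e - (0, n%:Z)) (nu a b n)
}.

Definition gauge_equiv (nu nu' : A -> A -> pser A) : Prop :=
  exists phi : pser A -> pser A,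
    [/\ hlinear phi, bijective phi,
        forall f g, phi (star nu f g) = star nu' (phi f) (phi g),
        Z2_homogeneous phi &
        forall f, phi f 0%N = f 0%N].

Definition nontrivial_deformation (nu : A -> A -> pser A) : Prop :=
  ~ gauge_equiv nu (fun _ _ => 0).

End NilHecke.

(* Main.v *)
(* Let * be the deformed product mu + nu.  For degree reasons the generators
   satisfy in it all the undeformed relations, except that
   sigma_i * X_j - X_(s_i j) * sigma_i is a multiple of hbar.  That the X_j
   commute forces these multiples to be c_i hbar, - c_i hbar for j = i, i + 1
   and 0 otherwise, and the braid relation forces all the c_i to be equal to
   one constant c.  If c = 0 the deformation is trivial; if c <> 0, sending
   X_i to X_i and sigma_i to c sigma_i defines an isomorphism onto NH_k, which
   is even C[[hbar]]-linear and strict.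

   The isomorphisms are obtained as follows.  Given two deformations of A with
   generators satisfying the same relations, let S be the C[hbar]-subalgebra
   of their product generated by the pairs of generators.  S / hbar S satisfies
   the relations of A, hence by the presentation of A it is a quotient of A,
   and so A itself: an element of S one of whose components is divisible by
   hbar is divisible by hbar.  Hence the completion of S is the graph of an
   isomorphism. *)
From HB Require Import structures.
Require Import Defs.
From mathcomp Require Import all_boot fingroup perm all_algebra complex.
From mathcomp Require Import boolp functions reals.
From mathcomp Require Import zify.

Set Implicit Arguments.
Unset Strict Implicit.
Unset Printing Implicit Defensive.

Import GRing.Theory.
Local Open Scope ring_scope.

(** * Words in the Coxeter generators *)

Section CoxeterWords.
Local Open Scope nat_scope.

(** The comparison works on words in the generators: it needs them homogeneous, with constant terms
    given by the words of A. For a graded deformation both follow from the grading. For NH_k only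
    the words X^a sigma_w with w reduced are prescribed, so every other word must be straightened
    while its degree and constant term are tracked. This requires that a product of sigmas be 0 or
    equal to a reduced one, whence the Coxeter combinatorics.

    The force of the grading: a word with x letters X and s letters sigma has degree (s - x, s), so
    A lives in degrees (p, q) with q >= p and q >= 0, and its part of degree (0, 0) consists of
    scalars. In a series of degree (p, q) the coefficient of hbar^n has degree (p, q - n). Hence
    products of X's alone or of sigmas alone admit no correction, and sigma X - X' sigma, of degree
    (0, 1), admits only a scalar times hbar. To compare these scalars one needs X_i <> X_j and
    sigma_i sigma_(i+1) <> 0 in A; both are read off from small representations that the
    presentation provides. *)

Inductive braid_equiv : seq nat -> seq nat -> Prop :=
| BraidRefl w : braid_equiv w w
| BraidTrans w1 w2 w3 :
    braid_equiv w1 w2 -> braid_equiv w2 w3 -> braid_equiv w1 w3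
| BraidSym w1 w2 : braid_equiv w1 w2 -> braid_equiv w2 w1
| BraidFar u v i j : i.+1 < j ->
    braid_equiv (u ++ [:: i, j & v]) (u ++ [:: j, i & v])
| BraidNear u v i :
    braid_equiv (u ++ [:: i, i.+1, i & v]) (u ++ [:: i.+1, i, i.+1 & v]).

Lemma braid_equiv_cat u v w1 w2 :
  braid_equiv w1 w2 -> braid_equiv (u ++ w1 ++ v) (u ++ w2 ++ v).
Proof.
elim=> {w1 w2} [w|w1 w2 w3 _ H1 _|w1 w2 _|u' v' i j ij|u' v' i].
- exact: BraidRefl.
- exact: BraidTrans.
- exact: BraidSym.
- by rewrite -!catA !catA -!(catA (u ++ u')) /=; apply: BraidFar.
- by rewrite -!catA !catA -!(catA (u ++ u')) /=; apply: BraidNear.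
Qed.

Lemma braid_equiv_catl u w1 w2 :
  braid_equiv w1 w2 -> braid_equiv (u ++ w1) (u ++ w2).
Proof. by move=> /(braid_equiv_cat u [::]); rewrite !cats0. Qed.

Lemma braid_equiv_catr v w1 w2 :
  braid_equiv w1 w2 -> braid_equiv (w1 ++ v) (w2 ++ v).
Proof. exact: (braid_equiv_cat [::]). Qed.

Lemma braid_equiv_size w1 w2 : braid_equiv w1 w2 -> size w1 = size w2.
Proof.
elim=> {w1 w2} [//|w1 w2 w3 _ -> _ -> //|w1 w2 _ -> //|u v i j _|u v i];
  by rewrite !size_cat.
Qed.

Lemma braid_equiv_bound b w1 w2 : braid_equiv w1 w2 ->
  all (fun i => i < b) w1 = all (fun i => i < b) w2.
Proof.
elim=> {w1 w2} [//|w1 w2 w3 _ -> _ -> //|w1 w2 _ -> //|u v i j _|u v i];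
  rewrite !all_cat /=; congr (_ && _).
- by rewrite andbCA.
- by case: (i < b); case: (i.+1 < b).
Qed.

Definition descent (j l : nat) : seq nat := rev (iota l (j.+1 - l)).

Lemma descent_head j l : l <= j -> descent j l = j :: rev (iota l (j - l)).
Proof. by move=> lj; rewrite /descent subSn // -addn1 iotaD rev_cat /= subnKC. Qed.

Lemma descentS j l : l <= j.+1 -> descent j.+1 l = j.+1 :: descent j l.
Proof. exact: descent_head. Qed.

Lemma descent_nil j l : j < l -> descent j l = [::].
Proof. by rewrite /descent -subn_eq0 => /eqP->. Qed.

Lemma descent_rcons j l : l <= j -> descent j l = rcons (descent j l.+1) l.
Proof.
by move=> lj; rewrite /descent subSS subSn //= rev_cons.
Qed.

Lemma descent_cat j i l : l <= i -> i <= j ->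
  descent j l = descent j i.+1 ++ descent i l.
Proof.
move=> li ij; rewrite /descent subSS.
have -> : j.+1 - l = (i.+1 - l) + (j - i) by lia.
by rewrite iotaD rev_cat; congr (rev (iota _ _) ++ _); lia.
Qed.

Lemma mem_descent j l i : (i \in descent j l) = (l <= i <= j).
Proof. rewrite /descent mem_rev mem_iota; lia. Qed.

(** Normal forms for the symmetric group on j + 1 points: one descending run for each top letter
    below [j], where [l = j] makes the last run empty. The runs are coset representatives for the
    chain of symmetric groups. Letters are plain naturals, so the induction on [j] changes no
    type. *)
Fixpoint staircase (j : nat) (n : seq nat) : Prop :=
  if j is j'.+1 then
    exists n' l, [/\ staircase j' n', l <= j & n = n' ++ descent j' l]
  else n = [::].

Lemma staircase_bound j n : staircase j n -> all (fun i => i < j) n.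
Proof.
elim: j n => [n -> //|j IH n [n' [l [/IH n'j lj ->]]]].
rewrite all_cat (sub_all _ n'j) => [|i /=]; last lia.
by apply/allP => i; rewrite mem_descent; lia.
Qed.

(** Serves twice: a square kills a product of sigmas, and it can be deleted without changing the
    permutation. *)
Definition has_square (w : seq nat) : Prop :=
  exists u i v, braid_equiv w (u ++ [:: i, i & v]).

Lemma has_square_catr w v : has_square w -> has_square (w ++ v).
Proof.
move=> [u [i [v' H]]]; exists u, i, (v' ++ v).
by have := braid_equiv_catr v H; rewrite -catA.
Qed.

Lemma has_square_equiv w1 w2 :
  braid_equiv w1 w2 -> has_square w2 -> has_square w1.
Proof. by move=> H [u [i [v H2]]]; exists u, i, v; apply: BraidTrans H2. Qed.

Lemma braid_equiv_far u i : all (fun j => i.+1 < j) u ->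
  braid_equiv (rcons u i) (i :: u).
Proof.
elim: u => [|j u IH] /= => [_|/andP[ij /IH H]]; first exact: BraidRefl.
apply: BraidTrans (braid_equiv_catl [:: j] H) _ => /=.
by apply: BraidSym; apply: (BraidFar [::]).
Qed.

Lemma braid_equiv_far' u i : all (fun j => j.+1 < i) u ->
  braid_equiv (rcons u i) (i :: u).
Proof.
elim: u => [|j u IH] /= => [_|/andP[ij /IH H]]; first exact: BraidRefl.
apply: BraidTrans (braid_equiv_catl [:: j] H) _ => /=.
by apply: (BraidFar [::]).
Qed.

(** The letter [i.+1] commutes with the letters below [i], a braid move on [i.+1, i, i.+1] turns it
    into [i], and this commutes with the letters above [i.+1]. *)
Lemma descent_braid j l i : l <= i -> i < j ->
  braid_equiv (rcons (descent j l) i.+1) (i :: descent j l).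
Proof.
move=> li ij; rewrite (@descent_cat j i.+1 l) //; last lia.
rewrite (@descentS i) //=; last lia.
rewrite (@descent_head i) // rcons_cat /=.
set u := descent _ _; set v := rev _.
apply: BraidTrans (_ : braid_equiv _ (u ++ [:: i.+1, i, i.+1 & v])) _.
  apply: braid_equiv_catl; apply: (braid_equiv_catl [:: i.+1; i]).
  by apply: braid_equiv_far'; apply/allP => x; rewrite mem_rev mem_iota; lia.
apply: BraidTrans (BraidSym (BraidNear u v i)) _.
have -> : u ++ [:: i, i.+1, i & v] = rcons u i ++ [:: i.+1, i & v].
  by rewrite cat_rcons.
rewrite -cat_cons; apply: braid_equiv_catr.
by apply: braid_equiv_far; apply/allP => x; rewrite mem_descent; lia.
Qed.

(** Let the last run end in [l]. Appending [i] makes a square if [i = l] and lengthens the run if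
    [i = l - 1]; otherwise the letter passes to the left of the run, as [i] or as [i - 1], where the
    smaller staircase absorbs it. *)
Lemma staircase_rcons j n i : staircase j n -> i < j ->
  has_square (rcons n i) \/
  exists2 n', staircase j n' & braid_equiv (rcons n i) n'.
Proof.
elim: j n i => [//|j IH n i [n' [l [n'j lj ->]]] ij].
rewrite rcons_cat.
have move_left x : x < j -> braid_equiv (rcons (descent j l) i) (x :: descent j l) ->
    has_square (n' ++ rcons (descent j l) i) \/
  exists2 m, staircase j.+1 m & braid_equiv (n' ++ rcons (descent j l) i) m.
  move=> xj H; have H2 := braid_equiv_catl n' H.
  rewrite -cat_rcons in H2.
  case: (IH n' x n'j xj) => [sq|[m mj Hm]].
    by left; apply: has_square_equiv H2 _; apply: has_square_catr.
  right; exists (m ++ descent j l); first by exists m, l.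
  by apply: BraidTrans H2 _; apply: braid_equiv_catr.
have [il|il|il] := ltngtP i l.
- have [il1|il1] := eqVneq i.+1 l.
    right; exists (n' ++ descent j i); first by exists n', i; split => //; lia.
    by rewrite -il1 -descent_rcons; [exact: BraidRefl | lia].
  apply: (move_left i); first lia.
  by apply: braid_equiv_far; apply/allP => x; rewrite mem_descent; lia.
- have Ei : i = i.-1.+1 by lia.
  by apply: (move_left i.-1); [lia | rewrite {1}Ei; apply: descent_braid; lia].
- left; exists (n' ++ descent j l.+1), l, [::].
  rewrite descent_rcons ?il; last lia.
  rewrite -!cats1 -!catA; exact: BraidRefl.
Qed.

Lemma staircase_nil j : staircase j [::].
Proof. by elim: j => [//|j IH]; exists [::], j.+1; rewrite descent_nil. Qed.

Lemma braid_normal_form j w : all (fun i => i < j) w ->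
  has_square w \/ exists2 n, staircase j n & braid_equiv w n.
Proof.
elim/last_ind: w => [_|w i IH].
  by right; exists [::]; [exact: staircase_nil | exact: BraidRefl].
rewrite all_rcons => /andP[ij /IH [sq|[n nj wn]]].
  by left; rewrite -cats1; apply: has_square_catr.
have H : braid_equiv (rcons w i) (rcons n i).
  by rewrite -!cats1; apply: braid_equiv_catr.
case: (staircase_rcons nj ij) => [sq|[n' n'j nn']].
  by left; apply: has_square_equiv sq.
by right; exists n' => //; apply: BraidTrans nn'.
Qed.

Definition swap (i x : nat) : nat :=
  if x == i then i.+1 else if x == i.+1 then i else x.

Definition act (w : seq nat) (x : nat) : nat := foldl (fun y i => swap i y) x w.

Lemma swapK i : involutive (swap i).
Proof.
by move=> x; rewrite /swap; (do ?case: ifP); lia.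
Qed.

Lemma act_cat u v x : act (u ++ v) x = act v (act u x).
Proof. by rewrite /act foldl_cat. Qed.

Lemma act_inj w : injective (act w).
Proof.
elim: w => [//|i w IH] x y /IH /(congr1 (swap i)).
by rewrite !swapK.
Qed.

Lemma act_fix w x : all (fun i => i.+1 < x) w -> act w x = x.
Proof.
elim: w => [//|i w IH] /= /andP[ix wx].
have -> : swap i x = x by rewrite /swap; (do ?case: ifP); lia.
exact: IH.
Qed.

Lemma act_equiv w1 w2 : braid_equiv w1 w2 -> act w1 =1 act w2.
Proof.
elim=> {w1 w2} [//|w1 w2 w3 _ H1 _ H2|w1 w2 _ H|u v i j ij|u v i] x.
- by rewrite H1.
- by rewrite H.
- rewrite !act_cat /=; congr (act v _); rewrite /swap.
  (do ?case: ifP); lia.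
- rewrite !act_cat /=; congr (act v _); rewrite /swap.
  (do ?case: ifP); lia.
Qed.

Lemma act_descent j l : l <= j.+1 -> act (descent j l) j.+1 = l.
Proof.
elim: j => [|j IH] lj.
  case: l lj => [|[|l]] //.
have [l1|l1] := leqP l j.+1; last by rewrite descent_nil //=; lia.
rewrite descentS //= (_ : swap _ _ = j.+1) ?IH // /swap.
by (do ?case: ifP); lia.
Qed.

(** All runs but the last leave the top point in place, so its image under the whole word is the end
    [l] of the last run, which can then be cancelled. *)
Lemma staircase_inj j n1 n2 : staircase j n1 -> staircase j n2 ->
  act n1 =1 act n2 -> n1 = n2.
Proof.
elim: j n1 n2 => [n1 n2 -> -> //|j IH n1 n2].
move=> [m1 [l1 [s1 lj1 ->]]] [m2 [l2 [s2 lj2 ->]]] E.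
have El : l1 = l2.
  have := E j.+1; rewrite !act_cat.
  rewrite (@act_fix m1 j.+1 (staircase_bound s1)) (@act_fix m2 j.+1 (staircase_bound s2)).
  by rewrite !act_descent.
congr (_ ++ _); last by rewrite El.
apply: IH => // x; apply: (@act_inj (descent j l1)).
by rewrite -act_cat E act_cat El.
Qed.

(** Induction on the length of [w]: a square can be deleted; without one, [w] is braid equivalent to
    a staircase with the same action, which is [n], and braid moves keep the length. *)
Lemma staircase_minimal j n w : staircase j n -> all (fun i => i < j) w ->
  act w =1 act n -> size n <= size w.
Proof.
move=> sn; elim: {w}(size w) {-2}w (leqnn (size w)) => [|N IH] w wN wj E.
  move: wN E; rewrite leqn0 size_eq0 => /eqP-> E.
  by rewrite (staircase_inj sn (staircase_nil j) (fsym E)).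
case: (braid_normal_form wj) => [[u [i [v H]]]|[n' sn' H]].
- have Ew := braid_equiv_size H; rewrite size_cat /= in Ew.
  apply: leq_trans (_ : size (u ++ v) <= _); last by rewrite size_cat; lia.
  apply: IH; first by rewrite size_cat; lia.
    move: wj; rewrite (braid_equiv_bound _ H) !all_cat /=.
    by case: (all _ u) => //=; case: (i < j).
  move=> x; rewrite -E (act_equiv H) !act_cat /=.
  by rewrite swapK.
- rewrite (braid_equiv_size H).
  rewrite (staircase_inj sn sn') // => x.
  by rewrite -E (act_equiv H).
Qed.

End CoxeterWords.

(** * Products of generators under the nilCoxeter relations *)

Section NilCoxeter.
Context {k : nat} {V : zmodType}.
Variables (mul : V -> V -> V) (one : V) (sigma : 'I_k.-1 -> V).
Hypotheses (mul0l : forall x, mul 0 x = 0) (mul0r : forall x, mul x 0 = 0).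
Hypothesis mulA : associative mul.
Hypothesis sigma_square : forall i, mul (sigma i) (sigma i) = 0.
Hypothesis sigma_braid : forall i j : 'I_k.-1, j = i.+1 :> nat ->
  mul (mul (sigma i) (sigma j)) (sigma i) =
  mul (mul (sigma j) (sigma i)) (sigma j).
Hypothesis sigma_far : forall i j : 'I_k.-1, (i.+1 < j)%N ->
  mul (sigma i) (sigma j) = mul (sigma j) (sigma i).

(* Out of range generators are sent to 0, which preserves the relations. *)
Let tau (i : nat) : V := oapp sigma 0 (insub i).
Let tau_prod (w : seq nat) : V := foldr mul one (map tau w).

Lemma tau_square i : mul (tau i) (tau i) = 0.
Proof. by rewrite /tau; case: insubP => //= j _ _. Qed.

Lemma tau_equiv w1 w2 : braid_equiv w1 w2 -> tau_prod w1 = tau_prod w2.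
Proof.
rewrite /tau_prod.
elim=> {w1 w2} [//|w1 w2 w3 _ -> _ -> //|w1 w2 _ -> //|u v i j ij|u v i];
  rewrite !map_cat !foldr_cat /=; congr (foldr _ _ _); rewrite !mulA;
  congr (mul _ _).
- rewrite /tau; case: insubP => [i' _ /= i'i|_] /=; last by rewrite mul0l mul0r.
  case: insubP => [j' _ /= j'j|_] /=; last by rewrite mul0l mul0r.
  by apply: sigma_far; rewrite i'i j'j.
- rewrite /tau; case: insubP => [i' _ /= i'i|_] /=; last by rewrite !(mul0l, mul0r).
  case: insubP => [j' _ /= j'j|_] /=; last by rewrite !(mul0l, mul0r).
  by apply: sigma_braid; rewrite i'i j'j.
Qed.

Lemma tau_prod_val (v : seq 'I_k.-1) :
  tau_prod (map val v) = foldr mul one (map sigma v).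
Proof.
rewrite /tau_prod -map_comp; congr (foldr _ _ _); apply: eq_map => i /=.
by rewrite /tau valK.
Qed.

Lemma word_permE (v : seq 'I_k.-1) (x : 'I_k) :
  word_perm v x = act (map val v) x :> nat.
Proof.
rewrite /word_perm; elim: v x => [|i v IH] x; first by rewrite big_nil perm1.
rewrite big_cons permM IH /=; congr act; rewrite /swap.
have ik : (i.+1 < k)%N by have := ltn_ord i; lia.
have hiE : hi i = i.+1 :> nat by rewrite /= modn_small.
case: tpermP => [->|->|/eqP n1 /eqP n2].
- by rewrite eqxx.
- by rewrite hiE eqxx; case: eqP => //; lia.
- rewrite -!val_eqE /= in n1 n2.
  by rewrite (negPf n1); move: n2; rewrite modn_small // => /negPf->.
Qed.

(** Braid moves lead to a square, with product 0, or to a staircase, which is reduced by minimality.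
    The equality of lengths is what keeps the degree. *)
Lemma nilcoxeter_reduce (v : seq 'I_k.-1) :
  foldr mul one (map sigma v) = 0 \/
  exists v', [/\ reduced v', size v' = size v &
    foldr mul one (map sigma v) = foldr mul one (map sigma v')].
Proof.
have bnd (u : seq 'I_k.-1) : all (fun i => (i < k.-1)%N) (map val u).
  by rewrite all_map; apply/allP => i _ /=; apply: ltn_ord.
case: (braid_normal_form (bnd v)) => [[u [i [w H]]]|[n sn H]].
  left; rewrite -tau_prod_val (tau_equiv H) /tau_prod map_cat foldr_cat /=.
  rewrite mulA tau_square mul0l; elim: (map tau u) => //= x s ->.
  by rewrite mul0r.
right; have [v' v'n] : exists v' : seq 'I_k.-1, n = map val v'.
  have := staircase_bound sn; elim: (n) => [|i m IH] /=; first by exists [::].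
  by case/andP => ik /IH [v' ->]; exists (Ordinal ik :: v').
exists v'; split.
- move=> w' E; rewrite -(size_map val v') -(size_map val w') -v'n.
  apply: (staircase_minimal sn) => // x.
  (* [act] is defined on all naturals, [word_perm] on points below [k] only; on the remaining points
     every word in range acts trivially. *)
  have [xk|xk] := ltnP x k; last first.
    have fixx u : all (fun i => i < k.-1)%N u -> act u x = x.
      by move=> ub; apply: act_fix; apply: sub_all ub => i /=; lia.
    by rewrite !fixx // staircase_bound.
  by rewrite v'n -!(word_permE _ (Ordinal xk)) E.
- by rewrite -(size_map val v') -v'n -(braid_equiv_size H) size_map.
- by rewrite -!tau_prod_val -v'n; apply: tau_equiv.
Qed.

End NilCoxeter.

(** * The bidegree of a word *)

Section WordDegree.
Context {k : nat}.
Implicit Types w : seq (@gen k).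

Lemma word_degree_cons g w : word_degree (g :: w) = gen_degree g + word_degree w.
Proof. by rewrite /word_degree big_cons. Qed.

Lemma word_degree_cat w1 w2 :
  word_degree (w1 ++ w2) = word_degree w1 + word_degree w2.
Proof. by rewrite /word_degree big_cat. Qed.

Lemma word_degreeE w : word_degree w =
  ((count (fun g => if g is inr _ then true else false) w)%:Z -
   (count (fun g => if g is inl _ then true else false) w)%:Z,
   (count (fun g => if g is inr _ then true else false) w)%:Z).
Proof.
elim: w => [|g w IH]; first by rewrite /word_degree big_nil.
rewrite word_degree_cons IH; case: g => i /=; congr pair => /=; lia.
Qed.

End WordDegree.

(** * Straightening words in the nilHecke relations *)

Section Straighten.
Context {k : nat} {V : zmodType}.
Variables (mul : V -> V -> V) (one h : V).
Variables (X : 'I_k -> V) (sigma : 'I_k.-1 -> V).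
Hypotheses (mulDl : left_distributive mul +%R)
           (mulDr : right_distributive mul +%R).
Hypothesis mulA : associative mul.
Hypothesis mul_h : forall x, mul x h = mul h x.
Hypothesis rels : nh_relations mul h X sigma.

Let W := word_prod mul one X sigma.

(** Integral combinations of h^n X^a sigma_v with [v] reduced, where [h] counts for degree (0, 1).
    The letters X stay unordered in [l] and are sorted only at the end. *)
Inductive straightened : int * int -> V -> Prop :=
| StraightBasis l v : reduced v ->
    straightened (word_degree (map inl l ++ map inr v))
                 (W (map inl l ++ map inr v))
| Straight0 d : straightened d 0
| StraightD d x y :
    straightened d x -> straightened d y -> straightened d (x + y)
| StraightN d x : straightened d x -> straightened d (- x)
| StraightH d x : straightened d x -> straightened (d + (0, 1)) (mul h x).

Let mul0l x : mul 0 x = 0.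
Proof. by apply: (addIr (mul 0 x)); rewrite -mulDl !add0r. Qed.

Let mul0r x : mul x 0 = 0.
Proof. by apply: (addIr (mul x 0)); rewrite -mulDr !add0r. Qed.

Let mulNr x y : mul x (- y) = - mul x y.
Proof. by apply/eqP; rewrite -addr_eq0 -mulDr addNr mul0r. Qed.

Let mulNl x y : mul (- x) y = - mul x y.
Proof. by apply/eqP; rewrite -addr_eq0 -mulDl addNr mul0l. Qed.

Let mul_hC x y : mul x (mul h y) = mul h (mul x y).
Proof. by rewrite !mulA mul_h. Qed.

Lemma straightened_X i d x :
  straightened d x -> straightened (gen_degree (inl i) + d) (mul (X i) x).
Proof.
elim=> {d x} [l v rv|d|d x y _ Hx _ Hy|d x _ Hx|d x _ Hx].
- by rewrite -word_degree_cons; apply: (StraightBasis (i :: l) rv).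
- by rewrite mul0r; apply: Straight0.
- by rewrite mulDr; apply: StraightD.
- by rewrite mulNr; apply: StraightN.
- by rewrite mul_hC addrA; apply: StraightH.
Qed.

Lemma word_degree_sigma (v : seq 'I_k.-1) :
  word_degree (map inr v) = ((size v)%:Z, (size v)%:Z).
Proof.
rewrite word_degreeE !count_map (eq_count (a2 := predT)) // count_predT.
by rewrite (eq_count (a2 := pred0)) // count_pred0 subr0.
Qed.

(** Exchanging sigma with an X leaves a correction by plus or minus h times the remaining word, of
    the right degree since (1, 1) + (-1, 0) = (0, 1). Once sigma reaches the other sigmas,
    [nilcoxeter_reduce] absorbs it. *)
Lemma straightened_sigma i d x :
  straightened d x -> straightened (gen_degree (inr i) + d) (mul (sigma i) x).
Proof.
elim=> {d x} [l v rv|d|d x y _ Hx _ Hy|d x _ Hx|d x _ Hx].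
- elim: l => [|j l IH].
    have [E|[v' [rv' sv' E]]] := nilcoxeter_reduce one mul0l mul0r mulA
      (nh_ss rels) (nh_braid rels) (nh_s_far rels) (i :: v).
      rewrite (_ : mul _ _ = 0); first exact: Straight0.
      by rewrite -[RHS]E /W /word_prod /= -map_comp.
    have -> : mul (sigma i) (W (map inl [::] ++ map inr v)) = W (map inr v').
      rewrite /W /word_prod -!map_comp; exact: E.
    have -> : gen_degree (inr i) + word_degree (map inl [::] ++ map inr v) =
        word_degree (map inr v').
      by rewrite -word_degree_cons -(map_cons inr) !word_degree_sigma sv'.
    exact: (StraightBasis [::] rv').
  set y := W (map inl l ++ map inr v) in IH *.
  have -> : W (map inl (j :: l) ++ map inr v) = mul (X j) y by [].
  set d := word_degree (map inl l ++ map inr v) in IH *.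
  have -> : word_degree (map inl (j :: l) ++ map inr v) = gen_degree (inl j) + d.
    by rewrite -word_degree_cons.
  rewrite mulA.
  have Hh : straightened (gen_degree (inr i) + (gen_degree (inl j) + d)) (mul h y).
    rewrite addrA (addrC _ d); apply: StraightH; exact: StraightBasis.
  have HX j' : straightened (gen_degree (inr i) + (gen_degree (inl j) + d))
      (mul (mul (X j') (sigma i)) y).
    by rewrite -mulA addrCA; apply: (straightened_X j').
  have [->|jlo] := eqVneq j (lo i).
    by rewrite (nh_sX_lo rels) mulDl; apply: StraightD.
  have [->|jhi] := eqVneq j (hi i).
    by rewrite (nh_sX_hi rels) mulDl mulNl; apply: StraightD => //; apply: StraightN.
  by rewrite (nh_sX_far rels).
- by rewrite mul0r; apply: Straight0.
- by rewrite mulDr; apply: StraightD.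
- by rewrite mulNr; apply: StraightN.
- by rewrite mul_hC addrA; apply: StraightH.
Qed.

Lemma straightened_word w : straightened (word_degree w) (W w).
Proof.
elim: w => [|g w IH]; first exact: (@StraightBasis [::] [::]).
rewrite word_degree_cons; case: g => i; first exact: straightened_X.
exact: straightened_sigma.
Qed.

Lemma word_prod_X_perm l1 l2 w : perm_eq l1 l2 ->
  W (map inl l1 ++ w) = W (map inl l2 ++ w).
Proof.
have XC i j x : mul (X i) (mul (X j) x) = mul (X j) (mul (X i) x).
  by rewrite !mulA (nh_XX rels).
have take_out i l : i \in l ->
    W (map inl l ++ w) = mul (X i) (W (map inl (rem i l) ++ w)).
  elim: l => //= j l IH; rewrite inE eq_sym; case: eqVneq => [->//|ji] /= il.
  by rewrite XC -IH.
elim: l1 l2 => [|i l1 IH] l2.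
  by move=> /perm_size /esym /eqP; rewrite size_eq0 => /eqP->.
move=> P; have il2 : i \in l2 by rewrite -(perm_mem P) mem_head.
rewrite (take_out i l2) // /W /= -/(W _); congr mul; apply: IH.
by rewrite -(perm_cons i) (perm_trans P) // perm_to_rem.
Qed.

(** Brings the commuting letters X into the order in which the basis of NH_k is prescribed. *)
Lemma word_prod_basis l v : W (map inl l ++ map inr v) =
  W (basis_word (fun i => count_mem i l) v).
Proof.
rewrite /basis_word.
have -> : flatten [seq nseq (count_mem i l) (inl i) | i <- enum 'I_k] =
  map (@inl 'I_k 'I_k.-1) (flatten [seq nseq (count_mem i l) i | i <- enum 'I_k]).
  rewrite map_flatten; congr flatten; rewrite -[RHS]map_comp.
  by apply: eq_map => i /=; rewrite map_nseq.
apply: word_prod_X_perm.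
rewrite perm_sym; apply/allP => /= j _; apply/eqP.
rewrite count_flatten -map_comp.
rewrite (eq_map (g := fun i => if i == j then count_mem j l else 0%N)); last first.
  by move=> i /=; rewrite count_nseq /=; case: eqP => [->|_]; rewrite ?mul1n.
rewrite sumnE big_map -big_mkcond /= big_enum_cond /=.
by rewrite big_pred1_eq.
Qed.

End Straighten.

(** * Subquotients of algebras *)

Section Subquotient.
Context {C : fieldType} {V : lmodType C}.
Variables (mul : V -> V -> V) (one : V) (S I : V -> Prop).

(** The product is a bare operation on [V], so that deformed products of power series are covered.
    [S] is a subalgebra and [I] an ideal for it; [sq_I1] makes the quotient a nonzero ring, as
    [algType] demands. *)
Record subquotient_axioms : Prop := SubquotientAxioms {
  sq_mul_l : forall c x y z, mul (c *: x + y) z = c *: mul x z + mul y z;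
  sq_mul_r : forall c x y z, mul z (c *: x + y) = c *: mul z x + mul z y;
  sq_mulA : associative mul;
  sq_mul1l : left_id one mul;
  sq_mul1r : right_id one mul;
  sq_S1 : S one;
  sq_SL : forall c x y, S x -> S y -> S (c *: x + y);
  sq_SM : forall x y, S x -> S y -> S (mul x y);
  sq_I0 : I 0;
  sq_IL : forall c x y, I x -> I y -> I (c *: x + y);
  sq_IMl : forall x y, S x -> I y -> I (mul x y);
  sq_IMr : forall x y, S x -> I y -> I (mul y x);
  sq_I1 : ~ I one
}.

Hypothesis ax : subquotient_axioms.

Let S0 : S 0.
Proof. by have := sq_SL ax (-1) (sq_S1 ax) (sq_S1 ax); rewrite scaleN1r addNr. Qed.
Let SD x y : S x -> S y -> S (x + y).
Proof. by move=> Sx Sy; have := sq_SL ax 1 Sx Sy; rewrite scale1r. Qed.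
Let SZ c x : S x -> S (c *: x).
Proof. by move=> Sx; have := sq_SL ax c Sx S0; rewrite addr0. Qed.
Let SN x : S x -> S (- x).
Proof. by move=> Sx; have := SZ (-1) Sx; rewrite scaleN1r. Qed.
Let ID x y : I x -> I y -> I (x + y).
Proof. by move=> Ix Iy; have := sq_IL ax 1 Ix Iy; rewrite scale1r. Qed.
Let IZ c x : I x -> I (c *: x).
Proof. by move=> Ix; have := sq_IL ax c Ix (sq_I0 ax); rewrite addr0. Qed.
Let IN x : I x -> I (- x).
Proof. by move=> Ix; have := IZ (-1) Ix; rewrite scaleN1r. Qed.
Let mulDl x y z : mul (x + y) z = mul x z + mul y z.
Proof. by have := sq_mul_l ax 1 x y z; rewrite !scale1r. Qed.
Let mulDr x y z : mul z (x + y) = mul z x + mul z y.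
Proof. by have := sq_mul_r ax 1 x y z; rewrite !scale1r. Qed.
Let mul0l z : mul 0 z = 0.
Proof. by apply: (addIr (mul 0 z)); rewrite -mulDl !add0r. Qed.
Let mul0r z : mul z 0 = 0.
Proof. by apply: (addIr (mul z 0)); rewrite -mulDr !add0r. Qed.
Let mulZl c x z : mul (c *: x) z = c *: mul x z.
Proof. by have := sq_mul_l ax c x 0 z; rewrite mul0l !addr0. Qed.
Let mulZr c x z : mul z (c *: x) = c *: mul z x.
Proof. by have := sq_mul_r ax c x 0 z; rewrite mul0r !addr0. Qed.
Let mulBl x y z : mul (x - y) z = mul x z - mul y z.
Proof. by rewrite mulDl -scaleN1r mulZl scaleN1r. Qed.
Let mulBr x y z : mul z (x - y) = mul z x - mul z y.
Proof. by rewrite mulDr -scaleN1r mulZr scaleN1r. Qed.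

Let coset (x : V) : pred V := fun y => `[< S y /\ I (x - y) >].
Let repr (x : V) : V := choose (coset x) x.

Let coset_refl x : S x -> coset x x.
Proof. by move=> Sx; apply/asboolP; rewrite subrr; split => //; apply: sq_I0. Qed.

Let reprP x : S x -> S (repr x) /\ I (x - repr x).
Proof. by move=> Sx; apply/asboolP; apply: (chooseP (coset_refl Sx)). Qed.

Let repr_eq x y : S x -> S y -> I (x - y) -> repr x = repr y.
Proof.
move=> Sx Sy Ixy.
have E : coset x =1 coset y.
  move=> z; apply/asboolP/asboolP => -[Sz Iz]; split=> //.
    by have := ID (IN Ixy) Iz; rewrite opprB addrA subrK.
  by have := ID Ixy Iz; rewrite addrA subrK.
rewrite /repr (eq_choose E); apply: choose_id; last exact: coset_refl.
by rewrite -E; apply: coset_refl.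
Qed.

(* S / I, realised on one chosen representative in S of each coset. *)
Definition subquotient_of of subquotient_axioms : Type :=
  {x : V | `[< S x >] && (repr x == x)}.
Local Notation Q := (subquotient_of ax).

HB.instance Definition _ := Choice.on Q.

Let valS (x : Q) : S (val x).
Proof. by case/andP: (valP x) => /asboolP. Qed.

Let Q0_subproof : `[< S (repr 0) >] && (repr (repr 0) == repr 0).
Proof.
have [Sr Ir] := reprP S0; apply/andP; split; first exact/asboolP.
by apply/eqP; symmetry; apply: repr_eq.
Qed.

Let pi (x : V) : Q := insubd (Sub (repr 0) Q0_subproof) (repr x).

Let pi_val (x : V) : S x -> val (pi x) = repr x.
Proof.
move=> Sx; rewrite val_insubd; have [Sr Ir] := reprP Sx.
by rewrite -(repr_eq Sx Sr Ir) eqxx andbT; case: asboolP.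
Qed.

Let pi_eq x y : S x -> S y -> I (x - y) -> pi x = pi y.
Proof. by move=> Sx Sy H; apply: val_inj; rewrite !pi_val //; apply: repr_eq. Qed.

Let valK (x : Q) : pi (val x) = x.
Proof. by apply: val_inj; rewrite pi_val //; case/andP: (valP x) => _ /eqP. Qed.

Let pi_repr x : S x -> I (x - val (pi x)).
Proof. by move=> Sx; rewrite pi_val //; case: (reprP Sx). Qed.

Let pi_eqE x y : S x -> S y -> pi x = pi y -> I (x - y).
Proof.
move=> Sx Sy E; have := ID (pi_repr Sx) (IN (pi_repr Sy)).
by rewrite E opprB addrA subrK.
Qed.

Let pi_ind (P : Q -> Prop) : (forall x, S x -> P (pi x)) -> forall q, P q.
Proof. by move=> H q; rewrite -(valK q); apply: H. Qed.

Let add (x y : Q) : Q := pi (val x + val y).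
Let opp (x : Q) : Q := pi (- val x).
Let scale (c : C) (x : Q) : Q := pi (c *: val x).
Let qmul (x y : Q) : Q := pi (mul (val x) (val y)).

Let piD x y : S x -> S y -> add (pi x) (pi y) = pi (x + y).
Proof.
move=> Sx Sy; apply: pi_eq; [by apply: SD | by apply: SD |].
rewrite opprD addrACA -opprB -(opprB y); apply: ID; apply: IN; exact: pi_repr.
Qed.

Let piN x : S x -> opp (pi x) = pi (- x).
Proof.
move=> Sx; apply: pi_eq; [by apply: SN | by apply: SN |].
by rewrite opprK addrC; apply: pi_repr.
Qed.

Let piZ c x : S x -> scale c (pi x) = pi (c *: x).
Proof.
move=> Sx; apply: pi_eq; [by apply: SZ | by apply: SZ |].
by rewrite -scalerBr; apply: IZ; rewrite -opprB; apply: IN; apply: pi_repr.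
Qed.

Let piM x y : S x -> S y -> qmul (pi x) (pi y) = pi (mul x y).
Proof.
move=> Sx Sy; apply: pi_eq; [by apply: sq_SM | by apply: sq_SM |].
rewrite -opprB; apply: IN.
rewrite -(subrK (mul (val (pi x)) y) (mul x y)) -addrA -mulBl -mulBr.
by apply: ID; [apply: (sq_IMr ax) | apply: (sq_IMl ax)] => //; apply: pi_repr.
Qed.

Let addA : associative add.
Proof.
elim/pi_ind=> x Sx; elim/pi_ind=> y Sy; elim/pi_ind=> z Sz.
by rewrite !piD ?addrA //; apply: SD.
Qed.

Let addC : commutative add.
Proof. by elim/pi_ind=> x Sx; elim/pi_ind=> y Sy; rewrite !piD // addrC. Qed.

Let add0 : left_id (pi 0) add.
Proof. by elim/pi_ind=> x Sx; rewrite piD // add0r. Qed.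

Let addN : left_inverse (pi 0) opp add.
Proof. by elim/pi_ind=> x Sx; rewrite piN // piD ?addNr //; apply: SN. Qed.

HB.instance Definition _ := GRing.isZmodule.Build Q addA addC add0 addN.

Let pi_add x y : S x -> S y -> pi x + pi y = pi (x + y) :> Q.
Proof. exact: piD. Qed.

Let scaleA a b v : scale a (scale b v) = scale (a * b) v.
Proof. by elim/pi_ind: v => x Sx; rewrite !piZ ?scalerA //; apply: SZ. Qed.

Let scale1 : left_id 1 scale.
Proof. by elim/pi_ind=> x Sx; rewrite piZ // scale1r. Qed.

Let scaleDr : right_distributive scale +%R.
Proof.
move=> c; elim/pi_ind=> x Sx; elim/pi_ind=> y Sy.
by rewrite pi_add // !piZ ?pi_add ?scalerDr //; first [by apply: SZ | by apply: SD].
Qed.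

Let scaleDl v : {morph scale^~ v : a b / a + b}.
Proof.
move=> a b; elim/pi_ind: v => x Sx.
by rewrite !piZ // pi_add ?scalerDl //; apply: SZ.
Qed.

HB.instance Definition _ := GRing.Zmodule_isLmodule.Build C Q
  scaleA scale1 scaleDr scaleDl.

Let qmulA : associative qmul.
Proof.
elim/pi_ind=> x Sx; elim/pi_ind=> y Sy; elim/pi_ind=> z Sz.
by rewrite !piM ?(sq_mulA ax) //; apply: (sq_SM ax).
Qed.

Let qmul1l : left_id (pi one) qmul.
Proof. by elim/pi_ind=> x Sx; rewrite piM ?(sq_mul1l ax) //; apply: sq_S1. Qed.

Let qmul1r : right_id (pi one) qmul.
Proof. by elim/pi_ind=> x Sx; rewrite piM ?(sq_mul1r ax) //; apply: sq_S1. Qed.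

Let qmulDl : left_distributive qmul +%R.
Proof.
elim/pi_ind=> x Sx; elim/pi_ind=> y Sy; elim/pi_ind=> z Sz.
by rewrite pi_add // !piM ?pi_add ?mulDl //; first [by apply: (sq_SM ax) | by apply: SD].
Qed.

Let qmulDr : right_distributive qmul +%R.
Proof.
elim/pi_ind=> x Sx; elim/pi_ind=> y Sy; elim/pi_ind=> z Sz.
by rewrite pi_add // !piM ?pi_add ?mulDr //; first [by apply: (sq_SM ax) | by apply: SD].
Qed.

Let qone_neq0 : pi one != 0.
Proof.
apply/eqP => /pi_eqE H; apply: (sq_I1 ax).
by rewrite -[one]subr0; apply: H => //; apply: sq_S1.
Qed.

HB.instance Definition _ := GRing.Zmodule_isNzRing.Build Q
  qmulA qmul1l qmul1r qmulDl qmulDr qone_neq0.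

Let qscaleAl (a : C) (x y : Q) : a *: (x * y) = (a *: x) * y.
Proof.
elim/pi_ind: x => x Sx; elim/pi_ind: y => y Sy.
rewrite /GRing.mul /= /GRing.scale /= piZ // !piM ?piZ ?mulZl //.
  exact: (sq_SM ax).
exact: SZ.
Qed.

HB.instance Definition _ := GRing.Lmodule_isLalgebra.Build C Q qscaleAl.

Let qscaleAr (a : C) (x y : Q) : a *: (x * y) = x * (a *: y).
Proof.
elim/pi_ind: x => x Sx; elim/pi_ind: y => y Sy.
rewrite /GRing.mul /= /GRing.scale /= piZ // !piM ?piZ ?mulZr //.
  exact: (sq_SM ax).
exact: SZ.
Qed.

HB.instance Definition _ := GRing.Lalgebra_isAlgebra.Build C Q qscaleAr.

(** Hides the construction: [p] is the projection, meaningful on [S] only, and [s] a section of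
    it. *)
Lemma subquotient_exists : exists (B : algType C) (p : V -> B) (s : B -> V),
  [/\ forall b, S (s b) /\ p (s b) = b,
      p one = 1,
      forall c x y, S x -> S y -> p (c *: x + y) = c *: p x + p y,
      forall x y, S x -> S y -> p (mul x y) = p x * p y &
      forall x y, S x -> S y -> p x = p y <-> I (x - y)].
Proof.
exists Q, pi, val; split=> //.
- by move=> c x y Sx Sy; rewrite -piD -?piZ //; apply: SZ.
- by move=> x y Sx Sy; rewrite -piM.
- by move=> x y Sx Sy; split; [apply: pi_eqE | apply: pi_eq].
Qed.

End Subquotient.

(** * Consequences of the presentation of A *)

Section Presentation.
Context {k : nat} {C : fieldType} {A : algType C}.
Variables (X : 'I_k -> A) (sigma : 'I_k.-1 -> A).
Hypothesis A_nh0 : is_nh0 X sigma.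

Let wordA := word_prod *%R 1 X sigma.

Definition comb {V : lmodType C} (W : seq (@gen k) -> V)
    (u : seq (C * seq (@gen k))) : V := \sum_(p <- u) p.1 *: W p.2.

Lemma comb_cons {V : lmodType C} (W : seq (@gen k) -> V) p u :
  comb W (p :: u) = p.1 *: W p.2 + comb W u.
Proof. by rewrite /comb big_cons. Qed.

Lemma comb_lin {V : lmodType C} (W : seq (@gen k) -> V) c u v :
  comb W ([seq (c * p.1, p.2) | p <- u] ++ v) = c *: comb W u + comb W v.
Proof.
rewrite /comb big_cat big_map scaler_sumr; congr (_ + _).
by apply: eq_bigr => p _; rewrite scalerA.
Qed.

Lemma word_prod_cat {T : Type} (mul : T -> T -> T) one (Y : 'I_k -> T) s w1 w2 :
  associative mul -> left_id one mul ->
  word_prod mul one Y s (w1 ++ w2) =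
  mul (word_prod mul one Y s w1) (word_prod mul one Y s w2).
Proof.
move=> mulA mul1; rewrite /word_prod map_cat.
by elim: w1 => [|g w1 IH] /=; rewrite ?mul1 // IH mulA.
Qed.

(** As [h] vanishes in S / I, the presentation gives a morphism from A to S / I. It sends each word
    to the class of the same word, so a linear relation between words of A persists modulo [I]. *)
Lemma word_relation {V : lmodType C} (mul : V -> V -> V) one (S I : V -> Prop)
    (ax : subquotient_axioms mul one S I) h Y s :
  nh_relations mul h Y s -> (forall i, S (Y i)) -> (forall i, S (s i)) ->
  S h -> I h ->
  forall u, comb wordA u = 0 -> I (comb (word_prod mul one Y s) u).
Proof.
move=> rels SY Ss Sh Ih u.
have [B [p [_ [_ p1 pL pM pE]]]] := subquotient_exists ax.
have SM x y := @sq_SM _ _ _ _ _ _ ax x y.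
have S0 : S 0 by have := sq_SL ax (-1) Sh Sh; rewrite scaleN1r addNr.
have p0 : p 0 = 0.
  have := pL (-1) h h Sh Sh; rewrite scaleN1r addNr => ->.
  by rewrite scaleN1r addNr.
have pD x y : S x -> S y -> p (x + y) = p x + p y.
  by move=> Sx Sy; have := pL 1 x y Sx Sy; rewrite !scale1r.
have ph : p h = 0 by rewrite -p0; apply/pE; rewrite ?subr0.
have pDh x : S x -> p (x + h) = p x by move=> Sx; rewrite pD // ph addr0.
have pBh x : S x -> p (x - h) = p x.
  move=> Sx; have := pL (-1) h x Sh Sx.
  by rewrite scaleN1r ph scaler0 add0r addrC.
have Brels : nh_relations *%R 0 (p \o Y) (p \o s).
  case: rels => r1 r2 r3 r4 r5 r6 r7.
  split=> /= [i j|i|i|i j ij ij'|i|i j ij|i j ij]; rewrite -!pM //; try exact: SM.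
  - by rewrite r1.
  - by rewrite r2 addr0 pDh //; apply: SM.
  - by rewrite r3 subr0 pBh //; apply: SM.
  - by rewrite r4.
  - by rewrite r5.
  - by rewrite r6.
  - by rewrite r7.
have [f [fX fs _]] := A_nh0.2 B _ _ Brels.
have Sword w : S (word_prod mul one Y s w).
  elim: w => [|[i|i] w IH]; first exact: (sq_S1 ax).
    exact: SM.
  exact: SM.
have fword w : f (wordA w) = p (word_prod mul one Y s w).
  elim: w => [|[i|i] w IH]; first by rewrite p1; apply: rmorph1.
    transitivity (f (X i) * f (wordA w)); first exact: rmorphM.
    by rewrite fX IH /= -pM.
  transitivity (f (sigma i) * f (wordA w)); first exact: rmorphM.
  by rewrite fs IH /= -pM.
have [Scomb fcomb] : S (comb (word_prod mul one Y s) u) /\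
    f (comb wordA u) = p (comb (word_prod mul one Y s) u).
  elim: u => [|q u [IH1 IH2]].
    by rewrite /comb !big_nil rmorph0.
  rewrite !comb_cons; split; first exact: (sq_SL ax).
  by rewrite pL // -IH2 -fword linearP.
move=> u0; rewrite u0 rmorph0 -p0 in fcomb.
by have := (pE _ _ S0 Scomb).1 fcomb => H; have := sq_IL ax (-1) H (sq_I0 ax);
  rewrite addr0 scaleN1r opprB subr0.
Qed.

(** The span of the words is an algebra satisfying the relations, so A maps to it. Followed by the
    inclusion this fixes the generators, and uniqueness in the presentation makes it the identity.
    The span becomes an [algType] as a subquotient with zero ideal. *)
Lemma word_spanning (a : A) : exists u, a = comb wordA u.
Proof.
pose S (a : A) := exists u, a = comb wordA u.
have SL c x y : S x -> S y -> S (c *: x + y).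
  by move=> [u ->] [v ->]; eexists; rewrite -comb_lin.
have S0 : S 0 by exists [::]; rewrite /comb big_nil.
have Sw w : S (wordA w).
  by exists [:: (1, w)]; rewrite /comb big_seq1 scale1r.
have SM x y : S x -> S y -> S (x * y).
  move=> [u ->] [v ->]; rewrite /comb mulr_suml.
  elim: u => [|p u IH]; first by rewrite big_nil.
  rewrite big_cons -scalerAl; apply: (SL) => // {IH}.
  elim: v => [|q v IH]; first by rewrite big_nil mulr0.
  rewrite big_cons mulrDr -scalerAr; apply: (SL) => //.
  by rewrite -word_prod_cat //; [exact: mulrA | exact: mul1r].
have ax : subquotient_axioms *%R 1 S (fun a => a = 0).
  split=> //.
  - by move=> c x y z; rewrite mulrDl scalerAl.
  - by move=> c x y z; rewrite mulrDr scalerAr.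
  - exact: mulrA.
  - exact: mul1r.
  - exact: mulr1.
  - exact: (Sw [::]).
  - by move=> c x y -> ->; rewrite scaler0 addr0.
  - by move=> x y _ ->; rewrite mulr0.
  - by move=> x y _ ->; rewrite mul0r.
  - exact/eqP/oner_neq0.
have [B [p [s [ps p1 pL pM pE]]]] := subquotient_exists ax.
have Ss b : S (s b) by case: (ps b).
have pinj x y : S x -> S y -> p x = p y -> x = y.
  by move=> Sx Sy /(pE _ _ Sx Sy) /subr0_eq.
have SX i : S (X i).
  by have := Sw [:: inl i]; rewrite /wordA /word_prod /= mulr1.
have Ssg i : S (sigma i).
  by have := Sw [:: inr i]; rewrite /wordA /word_prod /= mulr1.
have p0 : p 0 = 0.
  by have := pL (-1) 0 0 S0 S0; rewrite scaler0 addr0 scaleN1r addNr.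
have Brels : nh_relations *%R 0 (p \o X) (p \o sigma).
  case: A_nh0.1 => r1 r2 r3 r4 r5 r6 r7.
  split=> /= [i j|i|i|i j ij ij'|i|i j ij|i j ij]; rewrite -!pM //; try exact: SM.
  - by rewrite r1.
  - by rewrite r2 !addr0.
  - by rewrite r3 !subr0.
  - by rewrite r4.
  - by rewrite r5.
  - by rewrite r6.
  - by rewrite r7.
have [f [fX fs _]] := A_nh0.2 B _ _ Brels.
pose g a := s (f a).
have gL : linear g.
  move=> c x y; rewrite /g linearP; apply: pinj; [by []|exact: SL|].
  by rewrite pL // !(ps _).2.
have gM : monoid_morphism g.
  split=> [|x y]; rewrite /g ?rmorph1 ?rmorphM; apply: pinj => //.
  - exact: (Sw [::]).
  - by rewrite (ps _).2 p1.
  - exact: SM.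
  - by rewrite pM // !(ps _).2.
pose gR : {lrmorphism A -> A} := HB.pack g (GRing.isLinear.Build _ _ _ _ g gL)
  (GRing.isMonoidMorphism.Build _ _ g gM).
have [f0 [_ _ f0u]] := A_nh0.2 A X sigma A_nh0.1.
have -> : a = g a.
  transitivity (f0 a).
    by have := f0u idfun; apply.
  symmetry; apply: (f0u gR) => i.
  - by apply: (pinj (s (f (X i)))) => //; rewrite (ps _).2 fX.
  - by apply: (pinj (s (f (sigma i)))) => //; rewrite (ps _).2 fs.
exact: Ss.
Qed.

End Presentation.

(** * Power series *)

Section Series.
Context {C : fieldType} {A : algType C}.
Implicit Types (f g : pser A) (c : pser C).

(** Multiplication by hbar. *)
Definition hshift {B : zmodType} (f : pser B) : pser B :=
  fun n => if n is n'.+1 then f n' else 0.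

Lemma hshift_lin a f g : hshift (a *: f + g) = a *: hshift f + hshift g.
Proof. by apply/funext => -[|n] //=; rewrite !fctE scaler0 addr0. Qed.

Lemma hshift_inj : injective (@hshift A).
Proof. by move=> f g E; apply/funext => n; have := congr1 (@^~ n.+1) E. Qed.

Lemma hvarE : hvar = hshift (hconst 1) :> pser A.
Proof. by apply/funext => -[|[|n]]. Qed.

(** This recursion on the scalar lets statements about scalar series be proved modulo hbar^N by
    induction on N. *)
Lemma hscaleS c f :
  hscale c f = c 0%N *: f + hshift (hscale (fun n => c n.+1) f).
Proof.
apply/funext => n; rewrite !fctE /hscale big_ord_recl subn0.
congr (_ + _); case: n => [|n] /=; first by rewrite big_ord0.
by apply: eq_bigr => i _; rewrite /bump /= add1n subSS.
Qed.

Lemma hscale0 f : hscale (fun=> 0) f = 0.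
Proof.
by apply/funext => n; rewrite /hscale big1 // => i _; rewrite scale0r.
Qed.

Definition scalar_series (a : C) : pser C := fun n => if n is 0%N then a else 0.

Lemma hshift0 : hshift 0 = 0 :> pser A.
Proof. by apply/funext => -[|n]. Qed.

Lemma hshiftZ a f : hshift (a *: f) = a *: hshift f.
Proof. by rewrite -[a *: f]addr0 hshift_lin hshift0 addr0. Qed.

Lemma hscale_congr N c f g :
  hcongr N f g -> hcongr N (hscale c f) (hscale c g).
Proof.
move=> H n nN; apply: eq_bigr => i _.
by rewrite H // (leq_ltn_trans _ nN) // leq_subr.
Qed.

Lemma hscale_scalar a f : hscale (scalar_series a) f = a *: f.
Proof. by rewrite hscaleS hscale0 hshift0 addr0. Qed.

Lemma hscale_hvar f : hscale (hshift (scalar_series 1)) f = hshift f.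
Proof. by rewrite hscaleS scale0r add0r hscale_scalar scale1r. Qed.

Lemma hcongr_sub N f g : hcongr N f g <-> exists r, f - g = iter N hshift r.
Proof.
have it r n : iter N (@hshift A) r n = if (n < N)%N then 0 else r (n - N)%N.
  elim: N n => [|N IH] n; first by rewrite subn0.
  by case: n => [|n] //=; rewrite IH subSS.
split=> [H|[r E] i iN].
  exists (fun n => (f - g) (n + N)%N); apply/funext => n; rewrite it.
  case: ltnP => nN; last by rewrite subnK.
  by rewrite !fctE (H n nN) subrr.
by apply/eqP; rewrite -subr_eq0; have := congr1 (@^~ i) E; rewrite it iN => /eqP.
Qed.

Lemma hcongr_trans N f g h : hcongr N f g -> hcongr N g h -> hcongr N f h.
Proof. by move=> H1 H2 i iN; rewrite H1 ?H2. Qed.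

Lemma hcongr_sym N f g : hcongr N f g -> hcongr N g f.
Proof. by move=> H i iN; rewrite H. Qed.

Lemma hcongr_all f g : (forall N, hcongr N f g) -> f = g.
Proof. by move=> H; apply/funext => n; apply: (H n.+1). Qed.

Section HLinear.
Variable phi : pser A -> pser A.
Hypothesis phi_lin : hlinear phi.

Lemma hlinear_lin a f g : phi (a *: f + g) = a *: phi f + phi g.
Proof. by rewrite phi_lin.1 -hscale_scalar phi_lin.2 hscale_scalar. Qed.

Lemma hlinear0 : phi 0 = 0.
Proof. by have := hlinear_lin (-1) 0 0; rewrite scaler0 addr0 scaleN1r addNr. Qed.

Lemma hlinearB f g : phi (f - g) = phi f - phi g.
Proof. by rewrite addrC -scaleN1r hlinear_lin scaleN1r addrC. Qed.

Lemma hlinear_hshift f : phi (hshift f) = hshift (phi f).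
Proof. by rewrite -hscale_hvar phi_lin.2 hscale_hvar. Qed.

(** Linearity implies hbar-adic continuity, since divisibility by hbar^N is preserved. *)
Lemma hlinear_congr N f g : hcongr N f g -> hcongr N (phi f) (phi g).
Proof.
move=> /hcongr_sub [r E]; apply/hcongr_sub; exists (phi r).
rewrite -hlinearB E; elim: N {E} => //= N IH.
by rewrite hlinear_hshift IH.
Qed.

End HLinear.
End Series.

(** * Homogeneous power series *)

Section HomogeneousSeries.
Context {k : nat} {C : fieldType} {A : algType C}.
Variables (X : 'I_k -> A) (sigma : 'I_k.-1 -> A).

Lemma homog_lin d a x y :
  homog X sigma d x -> homog X sigma d y -> homog X sigma d (a *: x + y).
Proof.
move=> [u [du ->]] [v [dv ->]].
exists ([seq (a * p.1, p.2) | p <- u] ++ v); split.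
  by move=> p; rewrite mem_cat => /orP[/mapP[q qu ->]|/dv //]; apply: (du q).
exact: esym (comb_lin _ a u v).
Qed.

Lemma homog0 d : homog X sigma d 0.
Proof. by exists [::]; rewrite big_nil. Qed.

Lemma hhomog_lin n d a f g :
  hhomog X sigma n d f -> hhomog X sigma n d g -> hhomog X sigma n d (a *: f + g).
Proof. by move=> hf hg i ni; apply: homog_lin; [apply: hf|apply: hg]. Qed.

Lemma hhomog0 n d : hhomog X sigma n d 0.
Proof. by move=> i _; apply: homog0. Qed.

Lemma hhomog_hshift n d f :
  hhomog X sigma n d f -> hhomog X sigma n.+1 (d + (0, 1)) (hshift f).
Proof.
move=> hf [|i] ni /=; first exact: homog0.
have -> : d + (0, 1) - (0, i.+1%:Z) = d - (0, i%:Z).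
  by case: d {hf} => p q; congr pair => /=; lia.
exact: hf.
Qed.

Lemma hhomog_tail n d f :
  hhomog X sigma n.+1 d f -> hhomog X sigma n (d - (0, 1)) (fun i => f i.+1).
Proof.
move=> hf i ni.
have -> : d - (0, 1) - (0, i%:Z) = d - (0, i.+1%:Z).
  by case: d {hf} => p q; congr pair => /=; lia.
exact: hf.
Qed.

Lemma hhomog_comb n d (W : seq (@gen k) -> pser A) u :
  (forall w, hhomog X sigma n (word_degree w) (W w)) ->
  (forall p, p \in u -> word_degree p.2 = d) ->
  hhomog X sigma n d (comb W u).
Proof.
move=> hW; elim: u => [|p u IH] du; first by rewrite /comb big_nil; apply: hhomog0.
rewrite comb_cons; apply: hhomog_lin.
  by rewrite -(du p) ?mem_head.
by apply: IH => q qu; apply: du; rewrite inE qu orbT.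
Qed.

End HomogeneousSeries.

(** * Comparison of two deformations *)

Section Comparison.
Context {k : nat} {C : fieldType} {A : algType C}.
Variables (X : 'I_k -> A) (sigma : 'I_k.-1 -> A).
Hypothesis A_nh0 : is_nh0 X sigma.
Variables (m : bool -> pser A -> pser A -> pser A) (c : C).
Variables (Y : bool -> 'I_k -> pser A) (s : bool -> 'I_k.-1 -> pser A).
(** Relates the constant terms of words to A: the identity for a product [star nu], and for NH_k
    with generators X and c sigma the map of A that multiplies each sigma by c. *)
Variable theta : bool -> A -> A.
Hypothesis m_lin_l : forall b g, hlinear (fun f => m b f g).
Hypothesis m_lin_r : forall b f, hlinear (m b f).
Hypothesis mA : forall b, associative (m b).
Hypothesis m1l : forall b, left_id (hconst 1) (m b).
Hypothesis m1r : forall b, right_id (hconst 1) (m b).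
Hypothesis rels : forall b, nh_relations (m b) (c *: hvar) (Y b) (s b).

Let W b := word_prod (m b) (hconst 1) (Y b) (s b).
Let wordA := word_prod *%R 1 X sigma.

Hypothesis W0 : forall b w, W b w 0%N = theta b (wordA w).
Hypothesis W_homog : forall b w n, hhomog X sigma n (word_degree w) (W b w).
Hypothesis theta_lin : forall b, linear (theta b).
Hypothesis theta_inj : forall b, injective (theta b).
Hypothesis theta_surj : forall b a, exists a', theta b a' = a.
Hypothesis theta_homog : forall b d a, homog X sigma d a ->
  exists2 a', homog X sigma d a' & theta b a' = a.

Let V : lmodType C := (pser A * pser A)%type.
Let pr (b : bool) (x : V) : pser A := if b then x.1 else x.2.
Let mul (x y : V) : V := (m true x.1 y.1, m false x.2 y.2).
Let one : V := (hconst 1, hconst 1).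
Let shift (x : V) : V := (hshift x.1, hshift x.2).
Let YV i : V := (Y true i, Y false i).
Let sV i : V := (s true i, s false i).
Let WV := word_prod mul one YV sV.

Let prM b x y : pr b (mul x y) = m b (pr b x) (pr b y).
Proof. by case: b. Qed.

Let prL b a x y : pr b (a *: x + y) = a *: pr b x + pr b y.
Proof. by case: b. Qed.

Let pr_shift b x : pr b (shift x) = hshift (pr b x).
Proof. by case: b. Qed.

Let pr_inj x y : (forall b, pr b x = pr b y) -> x = y.
Proof.
by case: x y => [x1 x2] [y1 y2] E; congr pair; [apply: (E true)|apply: (E false)].
Qed.

Let pr_W b w : pr b (WV w) = W b w.
Proof.
elim: w => [|[i|i] w IH]; first by case: b.
  by rewrite -[WV _]/(mul (YV i) (WV w)) prM IH; case: b {IH}.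
by rewrite -[WV _]/(mul (sV i) (WV w)) prM IH; case: b {IH}.
Qed.

Let shift_lin a x y : shift (a *: x + y) = a *: shift x + shift y.
Proof. by apply: pr_inj => b; rewrite !(prL, pr_shift) hshift_lin. Qed.

Let mulA : associative mul.
Proof. by move=> x y z; apply: pr_inj => b; rewrite !prM mA. Qed.

Let mul1l : left_id one mul.
Proof. by move=> x; apply: pr_inj => b; rewrite prM; case: b; apply: m1l. Qed.

Let mul1r : right_id one mul.
Proof. by move=> x; apply: pr_inj => b; rewrite prM; case: b; apply: m1r. Qed.

Let mul_l a x y z : mul (a *: x + y) z = a *: mul x z + mul y z.
Proof.
by apply: pr_inj => b; rewrite !(prL, prM) (hlinear_lin (m_lin_l b _)).
Qed.

Let mul_r a x y z : mul z (a *: x + y) = a *: mul z x + mul z y.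
Proof.
by apply: pr_inj => b; rewrite !(prL, prM) (hlinear_lin (m_lin_r b _)).
Qed.

Let mul_shift_l x y : mul (shift x) y = shift (mul x y).
Proof.
by apply: pr_inj => b; rewrite !(pr_shift, prM) (hlinear_hshift (m_lin_l b _)).
Qed.

Let mul_shift_r x y : mul x (shift y) = shift (mul x y).
Proof.
by apply: pr_inj => b; rewrite !(pr_shift, prM) (hlinear_hshift (m_lin_r b _)).
Qed.

(* The C[hbar]-subalgebra generated by the pairs (Y true i, Y false i) and
   (s true i, s false i): the graph, up to completion, of the isomorphism. *)
Inductive graph : V -> Prop :=
| GraphWord w : graph (WV w)
| GraphLin a x y : graph x -> graph y -> graph (a *: x + y)
| GraphShift x : graph x -> graph (shift x).

Let graph0 : graph 0.
Proof.
by have := GraphLin (-1) (GraphWord [::]) (GraphWord [::]); rewrite scaleN1r addNr.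
Qed.

Let graph_mul x y : graph x -> graph y -> graph (mul x y).
Proof.
move=> gx; elim: gx y => {x} [w|a x x' _ IH _ IH'|x _ IH] y gy.
- elim: gy => {y} [w'|a y y' _ IH _ IH'|y _ IH].
  + by rewrite -word_prod_cat //; apply: GraphWord.
  + by rewrite mul_r; apply: GraphLin.
  + by rewrite mul_shift_r; apply: GraphShift.
- by rewrite mul_l; apply: GraphLin; [apply: IH|apply: IH'].
- by rewrite mul_shift_l; apply: GraphShift; apply: IH.
Qed.

Let hgraph (x : V) := exists2 y, graph y & x = shift y.

Let shift0 : shift 0 = 0.
Proof. by apply: pr_inj => b; rewrite pr_shift; case: b; apply: hshift0. Qed.

Let theta0 b : theta b 0 = 0.
Proof.
by have := theta_lin b (-1) 0 0; rewrite scaler0 addr0 scaleN1r addNr.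
Qed.

Let graph_axioms : subquotient_axioms mul one graph hgraph.
Proof.
split=> //.
- exact: (GraphWord [::]).
- exact: GraphLin.
- by exists 0.
- move=> a _ _ [x gx ->] [y gy ->]; exists (a *: x + y); first exact: GraphLin.
  by rewrite shift_lin.
- by move=> x _ gx [y gy ->]; exists (mul x y); [apply: graph_mul|].
- by move=> x _ gx [y gy ->]; exists (mul y x); [apply: graph_mul|].
- move=> [y gy /(congr1 (fun x => pr true x 0%N))].
  by rewrite pr_shift => /eqP; rewrite (oner_eq0 A).
Qed.

Let relsV : nh_relations mul (shift (c *: one)) YV sV.
Proof.
have hb b : pr b (shift (c *: one)) = c *: hvar.
  by rewrite pr_shift hvarE; case: b; apply: hshiftZ.
have D b (x y : V) : pr b (x + y) = pr b x + pr b y by case: b.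
have N b (x : V) : pr b (- x) = - pr b x by case: b.
have Z b : pr b 0 = 0 by case: b.
have EY b i : pr b (YV i) = Y b i by case: b.
have Es b i : pr b (sV i) = s b i by case: b.
split=> [i j|i|i|i j ij ij'|i|i j ij|i j ij]; apply: pr_inj => b;
  rewrite !(D, N, prM, hb, EY, Es).
- exact: (nh_XX (rels b)).
- exact: (nh_sX_lo (rels b)).
- exact: (nh_sX_hi (rels b)).
- exact: (nh_sX_far (rels b)).
- by rewrite Z; apply: (nh_ss (rels b)).
- exact: (nh_braid (rels b)).
- exact: (nh_s_far (rels b)).
Qed.

Let pr_comb0 b u : pr b (comb WV u) 0%N = theta b (comb wordA u).
Proof.
elim: u => [|p u IH]; first by rewrite /comb !big_nil theta0; case: b.
by rewrite !comb_cons prL !fctE pr_W IH W0 theta_lin.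
Qed.

Let graph_split x : graph x ->
  exists u y, graph y /\ x = comb WV u + shift y.
Proof.
elim=> {x} [w|a x x' _ [u [y [gy ->]]] _ [u' [y' [gy' ->]]]|x gx _].
- exists [:: (1, w)], 0; split=> //.
  by rewrite shift0 addr0 /comb big_seq1 scale1r.
- exists ([seq (a * p.1, p.2) | p <- u] ++ u'), (a *: y + y').
  split; first exact: GraphLin.
  by rewrite comb_lin shift_lin scalerDr addrACA.
- by exists [::], x; split=> //; rewrite /comb big_nil add0r.
Qed.

Let hgraph_comb u : comb wordA u = 0 -> hgraph (comb WV u).
Proof.
have g1 : graph (c *: one).
  by rewrite -[_ *: _]addr0; apply: GraphLin => //; apply: (GraphWord [::]).
apply: (word_relation A_nh0 graph_axioms relsV).
- move=> i; have := GraphWord [:: inl i].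
  by rewrite -[WV _]/(mul (YV i) one) mul1r.
- move=> i; have := GraphWord [:: inr i].
  by rewrite -[WV _]/(mul (sV i) one) mul1r.
- exact: GraphShift.
- by exists (c *: one).
Qed.

(* The presentation of A enters here: the quotient of the graph by hbar is
   generated by solutions of the relations at hbar = 0, so it is no larger
   than A. *)
Let graph_divisible b x : graph x -> pr b x 0%N = 0 -> hgraph x.
Proof.
move=> /graph_split [u [y [gy ->]]] x0.
have : comb wordA u = 0.
  apply: (@theta_inj b); rewrite theta0 -pr_comb0.
  move: x0; rewrite -[comb WV u]scale1r prL !fctE pr_shift /= addr0.
  by rewrite !scale1r.
move=> /hgraph_comb [z gz ->]; exists (z + y).
  by rewrite -[z]scale1r; apply: GraphLin.
by rewrite -[z]scale1r shift_lin !scale1r.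
Qed.

(** Repeated division by hbar: a power of hbar dividing one component divides the other. *)
Let graph_congr0 b b' N x : graph x -> hcongr N (pr b x) 0 -> hcongr N (pr b' x) 0.
Proof.
elim: N x => [//|N IH] x gx x0.
have [y gy xy] := graph_divisible gx (x0 0%N isT).
rewrite xy in x0 *; move=> [|i] iN; rewrite pr_shift //=.
apply: (IH y gy) => // j jN.
by have := x0 j.+1 jN; rewrite pr_shift.
Qed.

Let graph_congr b b' N x y : graph x -> graph y ->
  hcongr N (pr b x) (pr b y) -> hcongr N (pr b' x) (pr b' y).
Proof.
move=> gx gy H; have gxy := GraphLin (-1) gy gx.
have := @graph_congr0 b b' N _ gxy; rewrite !prL !scaleN1r => {}H2 i iN.
have /H2 /(_ i iN) /eqP : hcongr N (- pr b y + pr b x) 0.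
  by move=> j jN; rewrite !fctE (H j jN) addNr.
by rewrite !fctE addrC subr_eq0 => /eqP.
Qed.

Let graph_comb u : graph (comb WV u).
Proof.
elim: u => [|p u IH]; first by rewrite /comb big_nil.
by rewrite comb_cons; apply: GraphLin => //; apply: GraphWord.
Qed.

Let graph_cons u x : graph x -> graph (comb WV u + shift x).
Proof.
move=> gx; rewrite -[comb WV u]scale1r; apply: GraphLin; first exact: graph_comb.
exact: GraphShift.
Qed.

Let pr_cons b u x n : pr b (comb WV u + shift x) n =
  pr b (comb WV u) n + hshift (pr b x) n.
Proof. by rewrite -[comb WV u]scale1r prL pr_shift !fctE !scale1r. Qed.

(** Successive approximation: a combination of words takes care of the constant term, and the
    remainder divided by hbar is approximated in turn. *)
Let graph_dense b N f : exists2 x, graph x & hcongr N (pr b x) f.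
Proof.
elim: N f => [|N IH] f; first by exists 0.
have [a fa] := theta_surj b (f 0%N); have [u au] := word_spanning A_nh0 a.
have [x gx xf] := IH (fun i => f i.+1 - pr b (comb WV u) i.+1).
exists (comb WV u + shift x); first exact: graph_cons.
move=> [|i] iN; rewrite pr_cons /=; first by rewrite addr0 pr_comb0 -fa au.
by rewrite xf // addrC subrK.
Qed.

(** A homogeneous constant term comes from a combination of words of a single degree. Words are
    homogeneous in both algebras, so the approximation is homogeneous in both components at once. *)
Let graph_dense_homog b N d f : hhomog X sigma N d f ->
  exists2 x, graph x & hcongr N (pr b x) f /\
    forall b', hhomog X sigma N d (pr b' x).
Proof.
elim: N d f => [|N IH] d f hf; first by exists 0.
have [a ha fa] : exists2 a, homog X sigma d a & theta b a = f 0%N.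
  by apply: theta_homog; have := hf 0%N isT; rewrite subr0.
have [u [du au]] := ha.
have hu b' : hhomog X sigma N.+1 d (pr b' (comb WV u)).
  have -> : pr b' (comb WV u) = comb (W b') u.
    elim: (u) => [|p v IHv]; first by rewrite /comb !big_nil; case: b'.
    by rewrite !comb_cons prL IHv pr_W.
  by apply: hhomog_comb.
have [] := IH (d - (0, 1)) (fun i => f i.+1 - pr b (comb WV u) i.+1).
  move=> i iN; rewrite [X in homog _ _ _ X]addrC -scaleN1r; apply: homog_lin.
    exact: (hhomog_tail (hu b)).
  exact: (hhomog_tail hf).
move=> x gx [xf xh]; exists (comb WV u + shift x); first exact: graph_cons.
split=> [|b'].
  move=> [|i] iN; rewrite pr_cons /=; last by rewrite xf // addrC subrK.
  by rewrite addr0 pr_comb0 -fa au.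
rewrite -[comb WV u]scale1r prL pr_shift; apply: hhomog_lin => //.
by rewrite -(subrK (0, 1) d); apply: hhomog_hshift.
Qed.

Let Phi_ex b N f : exists x, graph x /\ hcongr N (pr b x) f.
Proof. by have [x gx xf] := graph_dense b N f; exists x. Qed.

(** Coefficient n is read off from some element of the graph that approximates [f] modulo
    hbar^(n+1); by [graph_congr] the choice does not matter. Keeping [b] general makes the inverse
    another instance of the same construction. *)
Let Phi b (f : pser A) : pser A :=
  fun n => pr (~~ b) (projT1 (cid (Phi_ex b n.+1 f))) n.

Let PhiP b N f x : graph x -> hcongr N (pr b x) f ->
  hcongr N (pr (~~ b) x) (Phi b f).
Proof.
move=> gx xf i iN; rewrite /Phi; case: (cid _) => y /= [gy yf].
apply: (@graph_congr b (~~ b) i.+1 x y) => // j ji.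
by rewrite xf ?yf // (leq_trans ji).
Qed.

Let PhiK b : cancel (Phi b) (Phi (~~ b)).
Proof.
move=> f; apply: hcongr_all => N; apply: hcongr_sym.
have [x gx xf] := graph_dense b N f.
have := PhiP gx (PhiP gx xf); rewrite negbK => H.
by apply: hcongr_trans H; apply: hcongr_sym.
Qed.

(** The graph is closed under polynomials in hbar only, so a multiple by a scalar series is
    approximated, in both components by one element. *)
Let Phi_scale x (a : pser C) N : graph x ->
  exists2 y, graph y & forall b, hcongr N (pr b y) (hscale a (pr b x)).
Proof.
move=> gx; elim: N a => [|N IH] a; first by exists 0.
have [y gy yx] := IH (fun n => a n.+1).
exists (a 0%N *: x + shift y) => [|b].
  by apply: GraphLin => //; apply: GraphShift.
rewrite prL pr_shift hscaleS => -[|i] iN; rewrite !fctE //=.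
by rewrite yx.
Qed.

Let Phi_mul f g : Phi true (m true f g) = m false (Phi true f) (Phi true g).
Proof.
apply: hcongr_all => N; apply: hcongr_sym.
have [x gx xf] := graph_dense true N f.
have [y gy yg] := graph_dense true N g.
have mcongr b f1 f2 g1 g2 : hcongr N f1 f2 -> hcongr N g1 g2 ->
    hcongr N (m b f1 g1) (m b f2 g2).
  move=> H1 H2; apply: (hcongr_trans (g := m b f2 g1)).
    exact: (hlinear_congr (m_lin_l b g1)).
  exact: (hlinear_congr (m_lin_r b f2)).
have gxy := graph_mul gx gy.
have H : hcongr N (pr true (mul x y)) (m true f g) by rewrite prM; apply: mcongr.
apply: hcongr_trans (PhiP gxy H); rewrite prM; apply: hcongr_sym.
by apply: mcongr; apply: PhiP.
Qed.

Let Phi_linear : hlinear (Phi true).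
Proof.
split=> [f g|a f]; apply: hcongr_all => N; apply: hcongr_sym;
  have [x gx xf] := graph_dense true N f.
  have [y gy yg] := graph_dense true N g.
  have gxy := GraphLin 1 gx gy.
  have H : hcongr N (pr true (1 *: x + y)) (f + g).
    by move=> i iN; rewrite prL !fctE scale1r xf ?yg.
  apply: hcongr_trans (PhiP gxy H) => i iN.
  by rewrite prL !fctE scale1r (PhiP gx xf) // (PhiP gy yg).
have [y gy yx] := Phi_scale a N gx.
have H : hcongr N (pr true y) (hscale a f).
  by apply: hcongr_trans (yx true) _; apply: hscale_congr.
apply: hcongr_trans (PhiP gy H); apply: hcongr_sym.
apply: hcongr_trans (yx false) _; apply: hscale_congr.
exact: (PhiP gx xf).
Qed.

(** The last clause gives the reduction of [phi] modulo hbar; when both [theta] are the identity, it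
    makes [phi] a gauge equivalence. *)
Lemma deformations_isomorphic : exists phi : pser A -> pser A,
  [/\ hlinear phi, bijective phi,
      forall f g, phi (m true f g) = m false (phi f) (phi g),
      Z2_homogeneous X sigma phi &
      forall f a, theta true a = f 0%N -> phi f 0%N = theta false a].
Proof.
exists (Phi true); split.
- exact: Phi_linear.
- by exists (Phi false); [apply: (PhiK true) | apply: (PhiK false)].
- exact: Phi_mul.
- move=> N; split=> [f g|d f /(graph_dense_homog true) [x gx [xf xh]]].
    exact: hlinear_congr.
  move=> i iN; rewrite -(PhiP gx xf) //; exact: xh.
- move=> f a fa.
  have [x gx xf] := graph_dense true 1 f.
  rewrite -(PhiP gx xf) //=.
  have [u [y [gy xy]]] := graph_split gx.
  have E b : pr b x 0%N = theta b (comb wordA u).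
    by rewrite xy pr_cons addr0 pr_comb0.
  have -> : a = comb wordA u by apply: (@theta_inj true); rewrite -E xf.
  exact: (E false).
Qed.

End Comparison.

(** * Graded deformations of A *)

(** Peeling off one coefficient of the scalar series at a time gives compatibility with it modulo
    each hbar^N. *)
Lemma hlinear_intro {C : fieldType} {A : algType C} (phi : pser A -> pser A) :
  (forall a f g, phi (a *: f + g) = a *: phi f + phi g) ->
  (forall f, phi (hshift f) = hshift (phi f)) -> hlinear phi.
Proof.
move=> phiL phiS; split=> [f g|c f]; first by have := phiL 1 f g; rewrite !scale1r.
apply: hcongr_all => N; elim: N c => [//|N IH] c i iN.
rewrite hscaleS phiL phiS [in RHS]hscaleS !fctE.
by case: i iN => //= i iN; rewrite IH.
Qed.

(** An element of the kernel has constant term 0, and its quotient by hbar is again in the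
    kernel. *)
Lemma hlinear_inj {C : fieldType} {A : algType C} (phi : pser A -> pser A) :
  hlinear phi -> (forall f, phi f 0%N = f 0%N) -> injective phi.
Proof.
move=> phiL phi0.
have ker n f : phi f = 0 -> f n = 0.
  elim: n f => [|n IH] f ff; first by rewrite -phi0 ff.
  have fS : f = hshift (fun i => f i.+1).
    by apply/funext => -[|i] //=; rewrite -phi0 ff.
  apply: (IH (fun i => f i.+1)); apply: hshift_inj.
  by rewrite -(hlinear_hshift phiL) -fS ff hshift0.
move=> f g fg; apply/funext => n; apply/eqP; rewrite -subr_eq0; apply/eqP.
by apply: (ker n (f - g)); rewrite (hlinearB phiL) fg subrr.
Qed.

(** * Bilinear extension to power series *)

Section Extend.
Context {C : fieldType} {A : algType C}.
Variable B : A -> A -> pser A.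
Hypothesis B_l : forall c a a' b, B (c *: a + a') b = c *: B a b + B a' b.
Hypothesis B_r : forall c a b b', B a (c *: b + b') = c *: B a b + B a b'.

Lemma bilinear0l b : B 0 b = 0.
Proof. by have := B_l (-1) 0 0 b; rewrite scaler0 addr0 scaleN1r addNr. Qed.

Lemma bilinear0r a : B a 0 = 0.
Proof. by have := B_r (-1) a 0 0; rewrite scaler0 addr0 scaleN1r addNr. Qed.

Lemma hextend_hconst a b : hextend B (hconst a) (hconst b) = B a b.
Proof.
apply/funext => n; rewrite /hextend big_ord_recl [X in _ + X]big1 => [|i _]; last first.
  by rewrite big1 // => j _; rewrite bilinear0l.
rewrite addr0 subn0 big_ord_recl [X in _ + X]big1 => [|i _]; last by rewrite bilinear0r.
by rewrite addr0 !subn0.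
Qed.

Lemma hextend_coef0 f g : hextend B f g 0%N = B (f 0%N) (g 0%N) 0%N.
Proof. by rewrite /hextend big_ord1 big_ord1. Qed.

Lemma hextend_linear_l g : hlinear (fun f => hextend B f g).
Proof.
apply: hlinear_intro => [a f f'|f]; apply/funext => n.
  rewrite !fctE /hextend scaler_sumr -big_split; apply: eq_bigr => i _ /=.
  rewrite scaler_sumr -big_split; apply: eq_bigr => j _ /=.
  by rewrite B_l.
rewrite /hextend big_ord_recl [X in X + _]big1 => [|j _]; last first.
  by rewrite bilinear0l.
rewrite add0r; case: n => [|n]; first by rewrite big_ord0.
by apply: eq_bigr => i _; reflexivity.
Qed.

Lemma hextend_linear_r f : hlinear (hextend B f).
Proof.
apply: hlinear_intro => [a g g'|g]; apply/funext => n.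
  rewrite !fctE /hextend scaler_sumr -big_split; apply: eq_bigr => i _ /=.
  rewrite scaler_sumr -big_split; apply: eq_bigr => j _ /=.
  by rewrite B_r.
case: n => [|n]; first by rewrite hextend_coef0 bilinear0r.
rewrite /hextend big_ord_recr /= subnn big_ord1 bilinear0r addr0.
apply: eq_bigr => i _; rewrite subSn; last by rewrite -ltnS.
rewrite big_ord_recl bilinear0r add0r; apply: eq_bigr => j _.
reflexivity.
Qed.

End Extend.

(** * The bigrading of A and the degrees where it vanishes *)

Section HomogA.
Context {k : nat} {C : fieldType} {A : algType C}.
Variables (X : 'I_k -> A) (sigma : 'I_k.-1 -> A).
Local Notation homog := (homog X sigma).
Local Notation hhomog := (hhomog X sigma).

Lemma homog_word w : homog (word_degree w) (word_prod *%R 1 X sigma w).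
Proof.
exists [:: (1, w)]; split=> [p|]; first by rewrite inE => /eqP->.
by rewrite big_seq1 scale1r.
Qed.

Lemma homog_gen g :
  homog (gen_degree g) (match g with inl i => X i | inr i => sigma i end).
Proof.
have := homog_word [:: g]; rewrite word_degree_cons /word_degree big_nil addr0.
by rewrite /word_prod /= mulr1.
Qed.

Lemma homog_mul d e a b : homog d a -> homog e b -> homog (d + e) (a * b).
Proof.
move=> [u [du ->]] [v [ev ->]]; rewrite mulr_suml.
elim: u du => [|p u IH] du; first by rewrite big_nil; apply: homog0.
rewrite big_cons -scalerAl; apply: homog_lin; last first.
  by apply: IH => q qu; apply: du; rewrite inE qu orbT.
have <- := du p (mem_head _ _); rewrite mulr_sumr.
elim: v ev {IH} => [|q v IHv] ev; first by rewrite big_nil; apply: homog0.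
rewrite big_cons -scalerAr; apply: homog_lin; last first.
  by apply: IHv => r rv; apply: ev; rewrite inE rv orbT.
have <- := ev q (mem_head _ _); rewrite -word_degree_cat -word_prod_cat.
- exact: homog_word.
- exact: mulrA.
- exact: mul1r.
Qed.

Lemma homog_eq0 (p q : int) a : (q < 0) || (q < p) -> homog (p, q) a -> a = 0.
Proof.
move=> pq [u [du ->]]; rewrite big1_seq // => x /= xu.
by have := du x xu; rewrite word_degreeE => -[]; lia.
Qed.

Lemma homog00 a : homog (0, 0) a -> exists c, a = c *: 1.
Proof.
move=> [u [du ->]].
elim: u du => [|x u IH] du; first by exists 0; rewrite big_nil scale0r.
rewrite big_cons; have [|c ->] := IH.
  by move=> y yu; apply: du; rewrite inE yu orbT.
have := du x (mem_head _ _); rewrite word_degreeE => -[E1 E2].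
case: x.2 E1 E2 => [|[i|i] w] /=; [|lia|lia] => _ _.
by exists (x.1 + c); rewrite scalerDl.
Qed.

(** The coefficient of hbar^n lies in degree (p, q - n), where A vanishes for every n > 0. *)
Lemma hhomog_const (p q : int) f :
  (forall n, hhomog n (p, q) f) -> (q <= p) || (q <= 0) -> f = hconst (f 0%N).
Proof.
move=> hf pq; apply/funext => -[//|n] /=.
by apply: (homog_eq0 _ (hf n.+2 n.+1 _)) => //=; lia.
Qed.

Lemma hhomog_hconst n d a : homog d a -> hhomog n d (hconst a).
Proof.
move=> ha [|i] _; last exact: homog0.
by rewrite subr0.
Qed.

End HomogA.

(** * The product of a graded deformation *)

Section GradedDeformation.
Context {k : nat} {C : fieldType} {A : algType C}.
Variables (X : 'I_k -> A) (sigma : 'I_k.-1 -> A).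
Variable nu : A -> A -> pser A.
Hypothesis nu_MC : graded_MC X sigma nu.
Local Notation homog := (homog X sigma).
Local Notation hhomog := (hhomog X sigma).
Local Notation m := (star nu).

Let B a b := hconst (a * b) + nu a b : pser A.

Let hconst_lin c (a b : A) : hconst (c *: a + b) = c *: hconst a + hconst b.
Proof. by apply/funext => -[|n]; rewrite !fctE //= scaler0 addr0. Qed.

Let B_l c a a' b : B (c *: a + a') b = c *: B a b + B a' b.
Proof.
rewrite /B (MC_linear_l nu_MC) mulrDl -scalerAl hconst_lin scalerDr.
by rewrite addrACA.
Qed.

Let B_r c a b b' : B a (c *: b + b') = c *: B a b + B a b'.
Proof.
rewrite /B (MC_linear_r nu_MC) mulrDr -scalerAr hconst_lin scalerDr.
by rewrite addrACA.
Qed.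

Lemma star_linear_l g : hlinear (fun f => m f g).
Proof. exact: hextend_linear_l. Qed.

Lemma star_linear_r f : hlinear (m f).
Proof. exact: hextend_linear_r. Qed.

Lemma star_coef0 f g : m f g 0%N = f 0%N * g 0%N.
Proof. by rewrite [LHS]hextend_coef0 !fctE (MC_positive nu_MC) addr0. Qed.

Lemma star_homog n d e f g :
  hhomog n d f -> hhomog n e g -> hhomog n (d + e) (m f g).
Proof.
move=> hf hg l ln; rewrite /star /hextend.
have sumP (I : finType) (F : I -> A) d' : (forall i, homog d' (F i)) ->
    homog d' (\sum_i F i).
  move=> H; elim/big_ind: _ => // [|x y hx hy]; first exact: homog0.
  by rewrite -[x]scale1r; apply: homog_lin.
apply: (sumP) => i; apply: (sumP) => j {sumP}.
have {}hf : homog (d - (0, (i : nat)%:Z)) (f i).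
  by apply: hf; rewrite (leq_ltn_trans _ ln) // -ltnS.
have {}hg : homog (e - (0, (j : nat)%:Z)) (g j).
  apply: hg; rewrite (leq_ltn_trans _ ln) // (leq_trans _ (leq_subr i l)) //.
  by rewrite -ltnS.
have E : d + e - (0, l%:Z) = (d - (0, (i : nat)%:Z)) + (e - (0, (j : nat)%:Z)) -
    (0, (l - i - j)%N%:Z).
  case: d {hf} => d1 d2; case: e {hg} => e1 e2.
  by have := ltn_ord i; have := ltn_ord j; move=> /= *; congr pair => /=; lia.
rewrite fctE -[hconst _ _]scale1r; apply: homog_lin; rewrite E.
  case: (l - i - j)%N => [|r]; last exact: homog0.
  by rewrite /= subr0; apply: homog_mul.
exact: (MC_degree nu_MC).
Qed.

Let h1_homog n : hhomog n (0, 0) (hconst 1).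
Proof.
by apply: hhomog_hconst; have := homog_word X sigma [::]; rewrite /word_degree big_nil.
Qed.

Let star11 : m (hconst 1) (hconst 1) = hconst 1.
Proof.
rewrite (@hhomog_const _ _ _ X sigma 0 0 (m (hconst 1) (hconst 1))) //.
  by rewrite star_coef0 mulr1.
by move=> n; rewrite -[(0, 0)]addr0; apply: star_homog.
Qed.

Lemma star_assoc : associative m.
Proof. exact: (MC_assoc nu_MC). Qed.

(** By degree 1 * 1 = 1, so f and 1 * f have the same product with 1 on the left; multiplication by
    1 is the identity modulo hbar, hence injective. *)
Lemma star1l : left_id (hconst 1) m.
Proof.
move=> f; apply: (hlinear_inj (star_linear_r (hconst 1))) => [g|].
  by rewrite star_coef0 mul1r.
by rewrite star_assoc star11.
Qed.

Lemma star1r : right_id (hconst 1) m.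
Proof.
move=> f; apply: (hlinear_inj (star_linear_l (hconst 1))) => [g|].
  by rewrite star_coef0 mulr1.
by rewrite -star_assoc star11.
Qed.

Let W := word_prod m (hconst 1) (fun i => hconst (X i)) (fun i => hconst (sigma i)).

Let W_cons g w : W (g :: w) =
  m (hconst (match g with inl i => X i | inr i => sigma i end)) (W w).
Proof. by case: g. Qed.

Lemma star_word_coef0 w : W w 0%N = word_prod *%R 1 X sigma w.
Proof.
elim: w => [//|g w IH]; rewrite W_cons star_coef0 IH.
by case: g.
Qed.

Lemma star_word_homog w n : hhomog n (word_degree w) (W w).
Proof.
elim: w => [|g w IH]; first by rewrite /word_degree big_nil; apply: h1_homog.
rewrite W_cons word_degree_cons; apply: star_homog => //.
by apply: hhomog_hconst; apply: homog_gen.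
Qed.

End GradedDeformation.

Section Indices.
Context {k : nat}.

Lemma hi_val (i : 'I_k.-1) : hi i = i.+1 :> nat.
Proof. by rewrite /= modn_small //; have := ltn_ord i; lia. Qed.

Lemma lo_neq_hi (i : 'I_k.-1) : lo i != hi i.
Proof. by apply/eqP => /(congr1 (@nat_of_ord k)); rewrite hi_val /=; lia. Qed.

Lemma hi_lo (i j : 'I_k.-1) : j = i.+1 :> nat -> hi i = lo j.
Proof. by move=> ji; apply: ord_inj; rewrite hi_val. Qed.

End Indices.

(** * Small representations of A *)

Section Representations.
Context {k : nat} {C : fieldType} {A : algType C}.
Variables (X : 'I_k -> A) (sigma : 'I_k.-1 -> A).
Hypothesis A_nh0 : is_nh0 X sigma.

(** Seen in the one-dimensional representation where X_i acts by 1 and all other generators by 0. *)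
Lemma X_neq i j : i != j -> X i != X j.
Proof.
move=> ij.
have rels : nh_relations *%R 0 (fun l => (l == i)%:R : C^o)
    (fun _ : 'I_k.-1 => 0 : C^o).
  by split=> *; rewrite ?mulr0 ?mul0r ?addr0 ?subr0 ?mulr0 ?mul0r // mulrC.
have [f [fX _ _]] := A_nh0.2 _ _ _ rels.
apply/eqP => E; have := fX i; rewrite E fX eqxx eq_sym (negPf ij) => /eqP.
by rewrite eq_sym oner_eq0.
Qed.

(** Let the X's act by 0 and sigma_l by the matrix unit E_(l, l+1). Both sides of the braid and far
    commutation relations vanish, but sigma_i sigma_(i+1) acts by E_(i, i+2). *)
Lemma sigma_sigma_neq0 (i j : 'I_k.-1) :
  j = i.+1 :> nat -> sigma i * sigma j != 0.
Proof.
move=> ji.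
pose s (l : 'I_k.-1) : 'M[C]_k.+1 := delta_mx (inord l) (inord l.+1).
have inordE (a b : nat) : (a <= k)%N -> (b <= k)%N ->
    ((inord a : 'I_k.+1) == inord b) = (a == b).
  by move=> ak bk; rewrite -val_eqE /= !inordK.
have lekS (l : 'I_k.-1) : (l.+1 <= k)%N by have := ltn_ord l; lia.
have lek (l : 'I_k.-1) : (l <= k)%N := ltnW (lekS l).
have sE a b : s a * s b = if (b == a.+1 :> nat) then
    delta_mx (inord a) (inord b.+1) else 0.
  rewrite /s /GRing.mul /= mul_delta_mx_cond inordE ?lek ?lekS //.
  by rewrite eq_sym; case: eqP => _; rewrite ?mulr1n ?mulr0n.
have ssE a b d : s a * s b * s d = if (b == a.+1 :> nat) && (d == b.+1 :> nat)
    then delta_mx (inord a) (inord d.+1) else 0.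
  rewrite sE; case: eqP => _; last by rewrite mul0r.
  rewrite /s /GRing.mul /= mul_delta_mx_cond inordE ?lek ?lekS //.
  by rewrite eq_sym; case: eqP => _; rewrite ?mulr1n ?mulr0n.
have rels : nh_relations *%R 0 (fun _ : 'I_k => 0 : 'M[C]_k.+1) s.
  split=> [a b|a|a|a b _ _|a|a b ab|a b ab];
    rewrite ?mulr0 ?mul0r ?addr0 ?subr0 //.
  - by rewrite sE; case: eqP => //; lia.
  - by rewrite !ssE; (do ?case: ifP) => //; lia.
  - by rewrite !sE; (do ?case: ifP) => //; lia.
have [f [_ fs _]] := A_nh0.2 _ _ _ rels.
apply/eqP => E.
have : f (sigma i) * f (sigma j) = 0.
  by transitivity (f (sigma i * sigma j)); [rewrite rmorphM | rewrite E rmorph0].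
rewrite !fs sE ji eqxx.
move=> /matrixP /(_ (inord i) (inord i.+2)).
by rewrite !mxE !eqxx => /eqP; rewrite oner_eq0.
Qed.

End Representations.

(** * The structure constants of a deformation *)

Section DeformedRelations.
Context {k : nat} {C : fieldType} {A : algType C}.
Variables (X : 'I_k -> A) (sigma : 'I_k.-1 -> A).
Hypothesis A_nh0 : is_nh0 X sigma.
Variable nu : A -> A -> pser A.
Hypothesis nu_MC : graded_MC X sigma nu.
Local Notation homog := (homog X sigma).
Local Notation hhomog := (hhomog X sigma).
Local Notation m := (star nu).
Local Notation hX := (fun i => hconst (X i) : pser A).
Local Notation hs := (fun i => hconst (sigma i) : pser A).

Let mA := star_assoc nu_MC.
Let mL := star_linear_l nu_MC.
Let mR := star_linear_r nu_MC.

Let hX_homog n i : hhomog n (-1, 0) (hX i).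
Proof. by apply: hhomog_hconst; apply: (homog_gen X sigma (inl i)). Qed.

Let hs_homog n i : hhomog n (1, 1) (hs i).
Proof. by apply: hhomog_hconst; apply: (homog_gen X sigma (inr i)). Qed.

Let m_homog n d e f g : hhomog n d f -> hhomog n e g -> hhomog n (d + e) (m f g).
Proof. exact: star_homog. Qed.

Let m_hvar_l f : m hvar f = hshift f.
Proof. by rewrite hvarE (hlinear_hshift (mL f)) (star1l nu_MC). Qed.

Let m_hvar_r f : m f hvar = hshift f.
Proof. by rewrite hvarE (hlinear_hshift (mR f)) (star1r nu_MC). Qed.

(** Degree (-2, 0) leaves no room for a correction; so do (2, 2) and (3, 3) for the products of
    sigmas below. *)
Let XX i j : m (hX i) (hX j) = hconst (X i * X j).
Proof.
rewrite (@hhomog_const _ _ _ X sigma (-2) 0 (m _ _)) //.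
  by rewrite (star_coef0 nu_MC).
move=> n; rewrite (_ : (-2, 0) = (-1, 0) + (-1, 0)) //.
exact: (m_homog (@hX_homog n i) (@hX_homog n j)).
Qed.

Let ss i j : m (hs i) (hs j) = hconst (sigma i * sigma j).
Proof.
rewrite (@hhomog_const _ _ _ X sigma 2 2 (m _ _)) //.
  by rewrite (star_coef0 nu_MC).
move=> n; rewrite (_ : (2, 2) = (1, 1) + (1, 1)) //.
exact: (m_homog (@hs_homog n i) (@hs_homog n j)).
Qed.

Let sss i j l : m (m (hs i) (hs j)) (hs l) = hconst (sigma i * sigma j * sigma l).
Proof.
rewrite (@hhomog_const _ _ _ X sigma 3 3 (m _ _)) //.
  by rewrite !(star_coef0 nu_MC).
move=> n; rewrite (_ : (3, 3) = (1, 1) + (1, 1) + (1, 1)) //.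
exact: (m_homog (m_homog (@hs_homog n i) (@hs_homog n j)) (@hs_homog n l)).
Qed.

(** The difference has degree (0, 1): its constant term vanishes by hypothesis, its coefficient of
    hbar is a scalar, and the later ones lie in degrees with negative second entry. *)
Let sX_ex i j j' : sigma i * X j = X j' * sigma i ->
  exists c, m (hs i) (hX j) = m (hX j') (hs i) + c *: hvar.
Proof.
move=> E; pose f : pser A := m (hs i) (hX j) - m (hX j') (hs i).
have hf n : hhomog n (0, 1) f.
  rewrite /f addrC -scaleN1r; apply: hhomog_lin.
    exact: (m_homog (@hX_homog n j') (@hs_homog n i)).
  exact: (m_homog (@hs_homog n i) (@hX_homog n j)).
have [c fc] : exists c, f 1%N = c *: 1.
  by apply: (@homog00 _ _ _ X sigma); apply: (hf 2%N 1%N isT).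
exists c; apply/eqP; rewrite addrC -subr_eq; apply/eqP; rewrite -/f.
apply/funext => -[|[|n]]; rewrite fctE.
- by rewrite /f !fctE !(star_coef0 nu_MC) /= E subrr scaler0.
- by rewrite fc.
- rewrite /= scaler0; apply: (homog_eq0 _ (hf n.+3 n.+2 _)) => //.
Qed.

(* If sigma X_j = X_j' sigma + p and sigma X_l = X_l' sigma + q in the
   deformed algebra, commuting X_j past X_l relates the constants p and q. *)
Let sXX i j j' l l' (p q : C) :
  m (hs i) (hX j) = m (hX j') (hs i) + p *: hvar ->
  m (hs i) (hX l) = m (hX l') (hs i) + q *: hvar ->
  q *: X j' + p *: X l = p *: X l' + q *: X j.
Proof.
have expand a a' b b' (u v : C) :
    m (hs i) (hX a) = m (hX a') (hs i) + u *: hvar ->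
    m (hs i) (hX b) = m (hX b') (hs i) + v *: hvar ->
    m (m (hs i) (hX a)) (hX b) =
    m (m (hX a') (hX b')) (hs i) + hshift (hconst (v *: X a' + u *: X b)).
  move=> Ea Eb; rewrite Ea addrC (hlinear_lin (mL _)) m_hvar_l -mA Eb.
  rewrite [in m (hX a') _]addrC (hlinear_lin (mR _)) m_hvar_r mA.
  rewrite addrC -addrA addrC -addrA; congr (_ + _).
  apply/funext => -[|[|n]]; rewrite !fctE /= ?scaler0 ?addr0 //.
  by rewrite addrC.
move=> Ej El; have := expand _ _ _ _ _ _ Ej El.
rewrite -mA XX (nh_XX A_nh0.1) -XX mA (expand _ _ _ _ _ _ El Ej).
rewrite !XX (nh_XX A_nh0.1 l') => /addrI /hshift_inj /(congr1 (@^~ 0%N)) /= E.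
by move: E; rewrite /hconst /= => ->.
Qed.

(** [sXX] gives (c + d) (X_hi - X_lo) = 0 for the constants c, d of the two moved indices, and e
    (X_hi - X_lo) = 0 for the constant e of any other index. *)
Let structure_constant i : exists c,
  [/\ m (hs i) (hX (lo i)) = m (hX (hi i)) (hs i) + c *: hvar,
      m (hs i) (hX (hi i)) = m (hX (lo i)) (hs i) - c *: hvar &
      forall j, j != lo i -> j != hi i -> m (hs i) (hX j) = m (hX j) (hs i)].
Proof.
have r := A_nh0.1.
have neq : X (hi i) - X (lo i) != 0.
  by rewrite subr_eq0; apply: (X_neq A_nh0); rewrite eq_sym lo_neq_hi.
have zero (c : C) : c *: X (hi i) = c *: X (lo i) -> c = 0.
  move=> /eqP; rewrite -subr_eq0 -scalerBr scaler_eq0 (negPf neq) orbF.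
  by move=> /eqP.
have [c Ec] : exists c, m (hs i) (hX (lo i)) = m (hX (hi i)) (hs i) + c *: hvar.
  by apply: sX_ex; rewrite (nh_sX_lo r) addr0.
have [d Ed] : exists d, m (hs i) (hX (hi i)) = m (hX (lo i)) (hs i) + d *: hvar.
  by apply: sX_ex; rewrite (nh_sX_hi r) subr0.
exists c; split=> //.
  rewrite Ed -scaleNr; congr (_ + _ *: _); apply/eqP; rewrite -addr_eq0; apply/eqP.
  by apply: zero; rewrite !scalerDl (sXX Ec Ed) addrC.
move=> j jlo jhi.
have [e Ee] := sX_ex (nh_sX_far r jlo jhi).
rewrite Ee (_ : e = 0) ?scale0r ?addr0 //; apply: zero.
by have := sXX Ec Ee; rewrite addrC => /addrI.
Qed.

(** Carry x across both sides of the braid relation: aba x = z aba + c hbar ab and bab x = z bab + d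
    hbar ab, where the other corrections contain aa = 0 or bb = 0. *)
Let constants_eq (i j : 'I_k.-1) c d : j = i.+1 :> nat ->
  m (hs i) (hX (lo i)) = m (hX (hi i)) (hs i) + c *: hvar ->
  m (hs j) (hX (lo j)) = m (hX (hi j)) (hs j) + d *: hvar -> c = d.
Proof.
move=> ji Ei Ej; have r := A_nh0.1.
have [_ [_ _ farI]] := structure_constant i.
have [_ [_ _ farJ]] := structure_constant j.
have {}farI : m (hs i) (hX (hi j)) = m (hX (hi j)) (hs i).
  by apply: farI; apply/eqP => /(congr1 (@nat_of_ord k)); rewrite !hi_val ?ji /=; lia.
have {}farJ : m (hs j) (hX (lo i)) = m (hX (lo i)) (hs j).
  by apply: farJ; apply/eqP => /(congr1 (@nat_of_ord k)); rewrite ?hi_val ?ji /= ?ji; lia.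
rewrite (hi_lo ji) in Ei.
set a := hconst (sigma i) in Ei farI *; set b := hconst (sigma j) in Ej farJ *.
set x := hconst (X (lo i)) in Ei farJ *; set y := hconst (X (lo j)) in Ei Ej *.
set z := hconst (X (hi j)) in Ej farI *.
have aa : m a a = 0 by rewrite ss (nh_ss r); apply/funext => -[|n].
have bb : m b b = 0 by rewrite ss (nh_ss r); apply/funext => -[|n].
have m0l f : m 0 f = 0 := hlinear0 (mL f).
have m0r f : m f 0 = 0 := hlinear0 (mR f).
have mDl u v f g : m (u + v *: f) g = v *: m f g + m u g.
  by rewrite addrC (hlinear_lin (mL g)).
have mDr u v f g : m g (u + v *: f) = v *: m g f + m g u.
  by rewrite addrC (hlinear_lin (mR g)).
have E1 : m (m (m a b) a) x = m z (m (m a b) a) + c *: hshift (m a b).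
  rewrite -mA Ei mDr m_hvar_r -!mA [m b (m y a)]mA Ej mDl m_hvar_l.
  rewrite (hlinear_lin (mR a)) (hlinear_hshift (mR a)) aa hshift0 scaler0 add0r.
  by rewrite addrC; congr (_ + _); rewrite !mA farI.
have E2 : m (m (m b a) b) x = m z (m (m b a) b) + d *: hshift (m a b).
  rewrite -mA farJ -!mA [m a (m x b)]mA Ei mDl m_hvar_l.
  rewrite (hlinear_lin (mR b)) (hlinear_hshift (mR b)) bb hshift0 scaler0 add0r.
  by rewrite -!mA [m b (m y _)]mA Ej mDl m_hvar_l addrC -!mA.
have : m (m a b) a = m (m b a) b by rewrite !sss (nh_braid r ji).
move=> E; rewrite E E2 in E1.
(* The coefficient of hbar reads (c - d) sigma_i sigma_j = 0 in A, up to sign. *)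
move: E1 => /addrI /(congr1 (@^~ 1%N)); rewrite !fctE /= /a /b ss /= => /eqP.
rewrite -subr_eq0 -scalerBl scaler_eq0 (negPf (sigma_sigma_neq0 A_nh0 ji)) orbF.
by rewrite subr_eq0 => /eqP.
Qed.

Lemma deformed_relations : exists c, nh_relations m (c *: hvar) hX hs.
Proof.
have [c Hc] : exists c, forall i,
  m (hs i) (hX (lo i)) = m (hX (hi i)) (hs i) + c *: hvar.
  (* Without any sigma every constant would do; 0 places this case among the trivial
     deformations. *)
  case: (posnP k.-1) => [k0|k1].
    by exists 0 => i; have := ltn_ord i; rewrite {2}k0.
  have [c [Ec _ _]] := structure_constant (Ordinal k1).
  exists c; case=> i; elim: i => [|i IH] ik.
    by rewrite (_ : Ordinal ik = Ordinal k1) //; apply: val_inj.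
  have [d [Ed _ _]] := structure_constant (Ordinal ik).
  by rewrite Ed -(constants_eq _ (IH (ltnW ik)) Ed).
exists c; have r := A_nh0.1.
have cE i : [/\ m (hs i) (hX (lo i)) = m (hX (hi i)) (hs i) + c *: hvar,
      m (hs i) (hX (hi i)) = m (hX (lo i)) (hs i) - c *: hvar &
      forall j, j != lo i -> j != hi i -> m (hs i) (hX j) = m (hX j) (hs i)].
  have [d [E1 E2 E3]] := structure_constant i.
  suff -> : c = d by [].
  have := E1; rewrite Hc => /addrI /(congr1 (@^~ 1%N)) /eqP.
  rewrite !fctE /= -subr_eq0 -scalerBl scaler_eq0 oner_eq0 orbF.
  by rewrite subr_eq0 => /eqP.
split.
- by move=> i j; rewrite !XX (nh_XX r).
- by move=> i; case: (cE i).
- by move=> i; case: (cE i).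
- by move=> i j; case: (cE i) => _ _; apply.
- by move=> i; rewrite ss (nh_ss r); apply/funext => -[|n].
- by move=> i j ij; rewrite !sss (nh_braid r ij).
- by move=> i j ij; rewrite !ss (nh_s_far r ij).
Qed.

End DeformedRelations.

(** * Words in the nilHecke algebra *)

Section NilHeckeWords.
Context {k : nat} {C : fieldType} {A : algType C}.
Variables (X : 'I_k -> A) (sigma : 'I_k.-1 -> A).
Hypothesis A_nh0 : is_nh0 X sigma.
Variable nh : pser A -> pser A -> pser A.
Hypothesis nh_NH : is_nh X sigma nh.
Local Notation hX := (fun i => hconst (X i) : pser A).
Local Notation hs := (fun i => hconst (sigma i) : pser A).

Let nhL := is_nh_linear_l nh_NH.
Let nhR := is_nh_linear_r nh_NH.
Let nhA : associative nh := is_nh_assoc nh_NH.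

Let nhDl : left_distributive nh +%R.
Proof. by move=> f g h; apply: (nhL h).1. Qed.

Let nhDr : right_distributive nh +%R.
Proof. by move=> f g h; apply: (nhR f).1. Qed.

Let nh_hvar f : nh f hvar = hshift f.
Proof. by rewrite hvarE (hlinear_hshift (nhR f)) (is_nh_one_r nh_NH). Qed.

Let hvar_nh f : nh hvar f = hshift f.
Proof. by rewrite hvarE (hlinear_hshift (nhL f)) (is_nh_one_l nh_NH). Qed.

Let W := word_prod nh (hconst 1) hX hs.
Let wordA := word_prod *%R 1 X sigma.

(* Straightening takes place simultaneously in NH_k and in A, that is, in the
   algebra pser A * A, where hbar becomes (hvar, 0). *)
Lemma nh_word w :
  (forall n, hhomog X sigma n (word_degree w) (W w)) /\ W w 0%N = wordA w.
Proof.
pose V : zmodType := (pser A * A)%type.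
pose mul (x y : V) : V := (nh x.1 y.1, x.2 * y.2).
pose XV i : V := (hconst (X i), X i); pose sV i : V := (hconst (sigma i), sigma i).
pose h : V := (hvar, 0); pose one : V := (hconst 1, 1).
have WV u : word_prod mul one XV sV u = (W u, wordA u).
  by elim: u => [//|[i|i] u IH]; rewrite /word_prod /= -/(word_prod _ _ _ _ _) IH.
have mulDl : left_distributive mul +%R.
  by move=> x y z; congr pair; [apply: nhDl | apply: mulrDl].
have mulDr : right_distributive mul +%R.
  by move=> x y z; congr pair; [apply: nhDr | apply: mulrDr].
have mulA : associative mul.
  by move=> x y z; congr pair; [apply: nhA | apply: mulrA].
have mul_h x : mul x h = mul h x.
  by congr pair; [rewrite nh_hvar hvar_nh | rewrite mulr0 mul0r].
have rn := is_nh_relations nh_NH; have ra := A_nh0.1.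
have rels : nh_relations mul h XV sV.
  split=> [i j|i|i|i j i1 i2|i|i j ij|i j ij]; congr pair.
  - exact: (nh_XX rn).
  - exact: (nh_XX ra).
  - exact: (nh_sX_lo rn).
  - exact: (nh_sX_lo ra).
  - exact: (nh_sX_hi rn).
  - exact: (nh_sX_hi ra).
  - exact: (nh_sX_far rn).
  - exact: (nh_sX_far ra).
  - exact: (nh_ss rn).
  - exact: (nh_ss ra).
  - exact: (nh_braid rn).
  - exact: (nh_braid ra).
  - exact: (nh_s_far rn).
  - exact: (nh_s_far ra).
have := straightened_word one mulDl mulDr mulA mul_h rels w.
suff H d x : straightened mul one h XV sV d x ->
    (forall n, hhomog X sigma n d x.1) /\ x.1 0%N = x.2.
  by move=> /H; rewrite WV.
elim=> {d x} [l v rv|d|d x y _ [hx Ex] _ [hy Ey]|d x _ [hx Ex]|d x _ [hx Ex]].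
(* The normalisation [is_nh_basis] enters here: a sorted word with reduced sigma part is a constant
   series in NH_k. *)
- rewrite WV /W (word_prod_basis _ nhA rn) (is_nh_basis nh_NH _ rv).
  rewrite -(word_prod_basis _ (@mulrA A) ra); split=> // n.
  by apply: hhomog_hconst; apply: homog_word.
- by split=> // n; apply: hhomog0.
- split=> [n|]; last exact: (f_equal2 +%R Ex Ey).
  have := hhomog_lin 1 (hx n) (hy n); by rewrite scale1r.
- split=> [n|]; last exact: (congr1 -%R Ex).
  by have := hhomog_lin (-1) (hx n) (@hhomog0 _ _ _ X sigma n d); rewrite scaleN1r addr0.
- rewrite /mul /= hvar_nh mul0r; split=> [[|n]|//]; first by move=> i; rewrite ltn0.
  exact: hhomog_hshift.
Qed.

End NilHeckeWords.

(** * Rescaling the generators sigma *)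

Section Rescaling.
Context {k : nat} {C : fieldType}.

Definition sigma_count (w : seq (@gen k)) : nat :=
  count (fun g => if g is inr _ then true else false) w.

Lemma word_prod_scale {V : lmodType C} (m : V -> V -> V) one
    (Y : 'I_k -> V) (s : 'I_k.-1 -> V) (c : C) w :
  (forall a x y, m (a *: x) y = a *: m x y) ->
  (forall a x y, m x (a *: y) = a *: m x y) ->
  word_prod m one Y (fun i => c *: s i) w =
  c ^+ sigma_count w *: word_prod m one Y s w.
Proof.
move=> mZl mZr; elim: w => [|[i|i] w IH]; first by rewrite scale1r.
  by rewrite /word_prod /= -!/(word_prod _ _ _ _ _) IH mZr.
rewrite /word_prod /= -!/(word_prod _ _ _ _ _) IH mZr mZl scalerA.
by rewrite add1n exprSr.
Qed.

(** The relations containing [h] are linear in the sigmas and the others homogeneous in them. Thus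
    NH_k with generators X and c sigma has parameter c hbar. *)
Lemma nh_relations_scale {V : lmodType C} (m : V -> V -> V) h
    (Y : 'I_k -> V) (s : 'I_k.-1 -> V) (c : C) :
  (forall a x y, m (a *: x) y = a *: m x y) ->
  (forall a x y, m x (a *: y) = a *: m x y) ->
  nh_relations m h Y s -> nh_relations m (c *: h) Y (fun i => c *: s i).
Proof.
move=> mZl mZr [r1 r2 r3 r4 r5 r6 r7].
split=> [i j|i|i|i j ij ij'|i|i j ij|i j ij]; rewrite ?(mZl, mZr).
- exact: r1.
- by rewrite r2 scalerDr.
- by rewrite r3 scalerBr.
- by rewrite r4.
- by rewrite r5 !scaler0.
- by rewrite r6.
- by rewrite r7.
Qed.

Context {A : algType C}.
Variables (X : 'I_k -> A) (sigma : 'I_k.-1 -> A).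
Hypothesis A_nh0 : is_nh0 X sigma.
Let wordA := word_prod *%R 1 X sigma.

(** At parameter 0 rescaling preserves the relations, so the presentation yields the endomorphism of
    A with sigma sent to c sigma. *)
Lemma sigma_scaling (c : C) : exists theta : A -> A, linear theta /\
  forall w, theta (wordA w) = c ^+ sigma_count w *: wordA w.
Proof.
have rels : nh_relations *%R 0 X (fun i => c *: sigma i).
  rewrite -(scaler0 _ c); apply: nh_relations_scale A_nh0.1 => a x y.
    by rewrite scalerAl.
  by rewrite scalerAr.
have [f [fX fs _]] := A_nh0.2 _ _ _ rels.
exists f; split=> [|w]; first exact: linearP.
rewrite -word_prod_scale => [|a x y|a x y]; [|by rewrite scalerAl|by rewrite scalerAr].
elim: w => [|[i|i] w IH]; first exact: rmorph1.
  transitivity (f (X i) * f (wordA w)); first exact: rmorphM.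
  by rewrite fX IH.
transitivity (f (sigma i) * f (wordA w)); first exact: rmorphM.
by rewrite fs IH.
Qed.

Lemma linear_comb (theta : A -> A) (W : seq (@gen k) -> A) u :
  linear theta -> theta (comb W u) = comb (theta \o W) u.
Proof.
move=> thL; have th0 : theta 0 = 0.
  by have := thL (-1) 0 0; rewrite scaler0 addr0 scaleN1r addNr.
elim: u => [|p u IH]; first by rewrite /comb !big_nil.
by rewrite !comb_cons thL IH.
Qed.

(** The inverse is the scaling by c^-1: the composites fix all words, and words span A. *)
Lemma sigma_scaling_bij (c : C) (theta : A -> A) : c != 0 -> linear theta ->
  (forall w, theta (wordA w) = c ^+ sigma_count w *: wordA w) ->
  exists theta' : A -> A, [/\ cancel theta theta', cancel theta' theta &
    forall d a, homog X sigma d a -> homog X sigma d (theta' a)].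
Proof.
move=> c0 thL thW; have [theta' [thL' thW']] := sigma_scaling c^-1.
have lin0 (f : A -> A) : linear f -> forall a x, f (a *: x) = a *: f x.
  move=> fL a x; have f0 : f 0 = 0.
    by have := fL (-1) 0 0; rewrite scaler0 addr0 scaleN1r addNr.
  by have := fL a x 0; rewrite f0 !addr0.
have eqc (f : A -> A) : linear f -> (forall w, f (wordA w) = wordA w) -> f =1 id.
  move=> fL fW a; have [u ->] := word_spanning A_nh0 a.
  by rewrite linear_comb //; apply: eq_bigr => p _; rewrite /= fW.
have compL (f g : A -> A) : linear f -> linear g -> linear (f \o g).
  by move=> fL gL a x y; rewrite /= gL fL.
exists theta'; split.
- apply: (eqc (theta' \o theta)) => [|w]; first exact: compL.
  rewrite /= thW (lin0 _ thL') thW' scalerA -exprMn divff // expr1n.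
  by rewrite scale1r.
- apply: (eqc (theta \o theta')) => [|w]; first exact: compL.
  rewrite /= thW' (lin0 _ thL) thW scalerA -exprMn mulVf // expr1n.
  by rewrite scale1r.
- move=> d a [u [du ->]].
  exists [seq (p.1 * c^-1 ^+ sigma_count p.2, p.2) | p <- u]; split.
    by move=> p /mapP[q qu ->]; apply: (du q).
  rewrite [LHS]linear_comb // /comb big_map; apply: eq_bigr => p _.
  by rewrite /= [theta' _]thW' scalerA.
Qed.

End Rescaling.

(** * Strict A-infinity isomorphisms *)

Section Strict.
Context {K : fieldType} {V W : lmodType K}.
Variables (mV : V -> V -> V) (mW : W -> W -> W) (phi : V -> W).
Hypotheses (mW0l : forall x, mW 0 x = 0) (mW0r : forall x, mW x 0 = 0).
Hypothesis phi_lin : linear phi.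
Hypothesis phi_bij : bijective phi.
Hypothesis phiM : forall x y, phi (mV x y) = mW (phi x) (phi y).

Definition strict_functor (s : seq V) : W := if s is [:: x] then phi x else 0.

Lemma blocks_flatten (s : seq V) p : p \in blocks s -> flatten p = s.
Proof.
elim: s p => [|x s IH] p /=; first by rewrite inE => /eqP->.
move=> /flattenP[_ /mapP[q /IH qs ->]].
rewrite inE => /orP[/eqP->/=|]; first by rewrite qs.
by case: q qs => //= b q <-; rewrite inE => /eqP->.
Qed.

Let phi0 : phi 0 = 0.
Proof. by have := phi_lin (-1) 0 0; rewrite scaler0 addr0 scaleN1r addNr. Qed.

Let F0 s : size s != 1%N -> strict_functor s = 0.
Proof. by case: s => [|x [|y s]]. Qed.

Let F00 s t : strict_functor (s ++ 0 :: t) = 0.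
Proof. by case: s => [|x [|y s]] //; case: t. Qed.

(** The relation in arity 2 is multiplicativity. In arity at least 3 both sides vanish: two blocks
    cannot both have length 1, and inserting one binary product leaves at least two entries. *)
Lemma strict_ainf_iso :
  ainf_iso deg0 (assoc_ops mV) deg0 (assoc_ops mW) strict_functor.
Proof.
split=> //; split=> //.
- move=> s t c x y; case: s => [|a s]; last first.
    by rewrite !F0 ?scaler0 ?addr0 //= size_cat /= addnS.
  by case: t => [|b t] /=; [apply: phi_lin | rewrite scaler0 addr0].
- move=> ds [|x [|y s]] [sz H]; try by right.
  case: ds sz H => [|p [|q ds]] //= _ /(_ x 0%N isT) /= [->|->]; last first.
    by right.
  by left; rewrite big_seq1.
- move=> ds [|x [|y [|z s]]] [sz H]; rewrite /insertions.
  + by rewrite /= big_seq1 big_ord0.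
  + by rewrite /= big_seq1 big_ord1 subn0 big_nat1 /= phi0 scaler0.
  + rewrite /= !big_cons big_nil /= !addr0.
    rewrite !big_ord_recl big_ord0 /= subn0 big_nat_recl // big_nat1 /=.
    rewrite subSS subn0 big_nat1 /= take0.
    by rewrite big_nil expr0z !scale1r scaler0 !addr0 add0r phiM.
  + rewrite big1_seq => [|p /andP[_ pb]]; last have ps := blocks_flatten pb.
      symmetry; apply: big1 => r _; apply: big1_seq => l /andP[_].
      rewrite mem_index_iota => /andP[l_gt0 lr].
      set s3 := [:: x, y, z & s] in r lr *.
      have lds : (l <= size (drop r s3))%N by rewrite size_drop -ltnS.
      have [l2|l2] := eqVneq l 2%N; last first.
        have sl : size (take l (drop r s3)) = l by rewrite size_takel.
        rewrite (_ : assoc_ops mV _ = 0) ?F00 ?scaler0 //.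
        by case: (take _ _) sl l2 => [|? [|? [|? ?]]] //= <-.
      rewrite F0 ?scaler0 // size_cat /= size_drop size_takel 1?ltnW // l2.
      by rewrite /s3 /= ; have := ltn_ord r; rewrite /s3 /=; lia.
    case: p ps {pb} => [|b1 [|b2 [|b3 p]]] //=; rewrite cats0 => E.
    have [b11|b11] := eqVneq (size b1) 1%N; last by rewrite (F0 b11) mW0l.
    rewrite [X in mW _ X]F0 //.
    by have := congr1 size E; rewrite size_cat b11 /=; lia.
Qed.

End Strict.

(** Reduces identities between C[[hbar]]-multilinear maps to constant series, as for associativity
    of the undeformed product. *)
Lemma hlinear_eq_hconst {C : fieldType} {A : algType C} (phi psi : pser A -> pser A) :
  hlinear phi -> hlinear psi ->
  (forall a, phi (hconst a) = psi (hconst a)) -> phi =1 psi.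
Proof.
move=> phL psL E f; apply: hcongr_all => N; elim: N f => [//|N IH] f.
have -> : f = 1 *: hconst (f 0%N) + hshift (fun n => f n.+1).
  by apply/funext => -[|n]; rewrite !fctE /= ?scale1r ?scaler0 ?addr0 ?add0r.
rewrite (hlinear_lin phL) (hlinear_lin psL) E (hlinear_hshift phL).
rewrite (hlinear_hshift psL) => -[|i] iN; rewrite !fctE //=.
by rewrite IH.
Qed.

(** * The trivial deformation *)

Section TrivialDeformation.
Context {k : nat} {C : fieldType} {A : algType C}.
Variables (X : 'I_k -> A) (sigma : 'I_k.-1 -> A).
Let nu0 (a b : A) : pser A := 0.
Local Notation m := (star nu0).

Let B (a b : A) : pser A := hconst (a * b) + 0.

Let hconst_lin c (a b : A) : hconst (c *: a + b) = c *: hconst a + hconst b.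
Proof. by apply/funext => -[|n]; rewrite !fctE //= scaler0 addr0. Qed.

Let B_l c a a' b : B (c *: a + a') b = c *: B a b + B a' b.
Proof. by rewrite /B !addr0 mulrDl -scalerAl hconst_lin. Qed.

Let B_r c a b b' : B a (c *: b + b') = c *: B a b + B a b'.
Proof. by rewrite /B !addr0 mulrDr -scalerAr hconst_lin. Qed.

Let mL g : hlinear (fun f => m f g) := hextend_linear_l B_l g.
Let mR f : hlinear (m f) := hextend_linear_r B_r f.

Lemma star0_hconst a b : m (hconst a) (hconst b) = hconst (a * b).
Proof. by rewrite [LHS](hextend_hconst B_l B_r) /B addr0. Qed.

Let hlinear_comp (phi psi : pser A -> pser A) :
  hlinear phi -> hlinear psi -> hlinear (phi \o psi).
Proof.
move=> [p1 p2] [q1 q2]; split=> [f g|c f] /=; first by rewrite q1 p1.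
by rewrite q2 p2.
Qed.

Lemma graded_MC0 : graded_MC X sigma nu0.
Proof.
split=> //.
- by move=> c a a' b; rewrite /nu0 scaler0 addr0.
- by move=> c a b b'; rewrite /nu0 scaler0 addr0.
- move=> f g h.
  apply: (hlinear_eq_hconst (phi := fun f => m f (m g h))
    (psi := (m^~ h) \o (m^~ g))) => // [|a]; first exact: hlinear_comp.
  apply: (hlinear_eq_hconst (phi := m (hconst a) \o (m^~ h))
    (psi := (m^~ h) \o (m (hconst a)))) => [||b]; try exact: hlinear_comp.
  apply: (hlinear_eq_hconst (phi := m (hconst a) \o m (hconst b))
    (psi := m (m (hconst a) (hconst b)))) => // [|d]; first exact: hlinear_comp.
  by rewrite /= !star0_hconst mulrA.
- by move=> d e a b n _ _; apply: homog0.
Qed.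

Lemma star0_relations : is_nh0 X sigma -> nh_relations m 0
  (fun i => hconst (X i)) (fun i => hconst (sigma i)).
Proof.
have hc0 : hconst 0 = 0 :> pser A by apply/funext => -[|n].
move=> [[r1 r2 r3 r4 r5 r6 r7] _].
split=> [i j|i|i|i j ij ij'|i|i j ij|i j ij]; rewrite !star0_hconst.
- by rewrite r1.
- by rewrite r2 !addr0.
- by rewrite r3 !subr0.
- by rewrite r4.
- by rewrite r5.
- by rewrite r6.
- by rewrite r7.
Qed.

End TrivialDeformation.

(** * The two cases c = 0 and c <> 0 *)

Section Classification.
Context {k : nat} {C : fieldType} {A : algType C}.
Variables (X : 'I_k -> A) (sigma : 'I_k.-1 -> A).
Hypothesis A_nh0 : is_nh0 X sigma.
Variable nu : A -> A -> pser A.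
Hypothesis nu_MC : graded_MC X sigma nu.
Local Notation hX := (fun i => hconst (X i) : pser A).
Local Notation hs := (fun i => hconst (sigma i) : pser A).

(** Comparison with the zero deformation at parameter 0, both with generators X and sigma; [theta]
    is the identity, so the isomorphism is the identity modulo hbar. *)
Lemma undeformed_relations_gauge :
  nh_relations (star nu) 0 hX hs -> gauge_equiv X sigma nu (fun _ _ => 0).
Proof.
move=> rels0; pose nus b : A -> A -> pser A := if b then nu else fun _ _ => 0.
have MC b : graded_MC X sigma (nus b) by case: b => //; apply: graded_MC0.
have [||||||||||||] := @deformations_isomorphic _ _ _ X sigma A_nh0
  (fun b => star (nus b)) 0 (fun=> hX) (fun=> hs) (fun=> id).
- by move=> b; apply: star_linear_l (MC b).
- by move=> b; apply: star_linear_r (MC b).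
- by move=> b; apply: star_assoc (MC b).
- by move=> b; apply: star1l (MC b).
- by move=> b; apply: star1r (MC b).
- move=> b; rewrite scale0r; case: b; first exact: rels0.
  exact: star0_relations.
- by move=> b w; apply: star_word_coef0 (MC b) _.
- by move=> b w n; apply: star_word_homog (MC b) _ _.
- by move=> b a x y.
- by move=> b x y.
- by move=> b a; exists a.
- by move=> b d a ha; exists a.
move=> phi [phiL phi_bij phiM phiH phi0]; exists phi; split=> //.
by move=> f; apply: phi0.
Qed.

(** Comparison at parameter c hbar, with generators X and c sigma in NH_k. Their words have rescaled
    constant terms, whence the scaling [theta] on that side, invertible as c <> 0. *)
Lemma deformed_relations_nh (c : C) nh : c != 0 ->
  nh_relations (star nu) (c *: hvar) hX hs -> is_nh X sigma nh ->
  exists phi : pser A -> pser A, [/\ hlinear phi, bijective phi,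
    forall f g, phi (star nu f g) = nh (phi f) (phi g) & Z2_homogeneous X sigma phi].
Proof.
move=> c0 rels nh_NH.
have nhL := is_nh_linear_l nh_NH; have nhR := is_nh_linear_r nh_NH.
have nhZl a (f g : pser A) : nh (a *: f) g = a *: nh f g.
  by rewrite -[a *: f]addr0 (hlinear_lin (nhL g)) (hlinear0 (nhL g)) addr0.
have nhZr a (f g : pser A) : nh f (a *: g) = a *: nh f g.
  by rewrite -[a *: g]addr0 (hlinear_lin (nhR f)) (hlinear0 (nhR f)) addr0.
have [theta [thL thW]] := sigma_scaling A_nh0 c.
have [theta' [thK thK' th'H]] := sigma_scaling_bij A_nh0 c0 thL thW.
have nhW w := nh_word A_nh0 nh_NH w.
have [||||||||||||] := @deformations_isomorphic _ _ _ X sigma A_nh0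
  (fun b => if b then star nu else nh) c (fun=> hX)
  (fun b i => if b then hs i else c *: hs i) (fun b => if b then id else theta).
- by case=> g; [apply: star_linear_l nu_MC g | apply: nhL].
- by case=> f; [apply: star_linear_r nu_MC f | apply: nhR].
- by case; [apply: star_assoc nu_MC | apply: is_nh_assoc nh_NH].
- by case; [apply: star1l nu_MC | apply: is_nh_one_l nh_NH].
- by case; [apply: star1r nu_MC | apply: is_nh_one_r nh_NH].
- by case=> //; apply: nh_relations_scale => //; apply: is_nh_relations nh_NH.
- case=> w; first exact: star_word_coef0 nu_MC w.
  by rewrite word_prod_scale // thW fctE (nhW w).2.
- case=> w n; first exact: star_word_homog nu_MC w n.
  rewrite word_prod_scale // -[_ *: _]addr0; apply: hhomog_lin.
    exact: (nhW w).1.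
  exact: hhomog0.
- by case=> // a x y.
- by case=> // x y /(congr1 theta'); rewrite !thK.
- by case=> a; [exists a | exists (theta' a); rewrite thK'].
- case=> d a ha; first by exists a.
  by exists (theta' a); [apply: th'H | rewrite thK'].
by move=> phi [phiL phi_bij phiM phiH _]; exists phi.
Qed.

End Classification.

Local Open Scope complex_scope.

Theorem proposition4p9 (R : realType) (k : nat) (k_gt0 : (0 < k)%N)
  (A : algType R[i]) (X : 'I_k -> A) (sigma : 'I_k.-1 -> A)
  (A_nh0 : is_nh0 X sigma)
  (nh : pser A -> pser A -> pser A) (nh_NH : is_nh X sigma nh)
  (nu : A -> A -> pser A) (nu_MC : graded_MC X sigma nu)
  (nu_nontrivial : nontrivial_deformation X sigma nu) :
  exists F : seq (pser A) -> pser A,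
    ainf_iso (K := R[i]) deg0 (assoc_ops (star nu)) deg0 (assoc_ops nh) F /\
    Z2_homogeneous_multi X sigma F.
Proof.
have [c rels] := deformed_relations A_nh0 nu_MC.
have c0 : c != 0.
  apply/eqP => c0; apply: nu_nontrivial; apply: (undeformed_relations_gauge A_nh0 nu_MC).
  by rewrite c0 scale0r in rels.
have [phi [phiL phi_bij phiM phiH]] := deformed_relations_nh A_nh0 nu_MC c0 rels nh_NH.
exists (strict_functor phi); split.
  apply: strict_ainf_iso => //.
  - by move=> f; apply: (hlinear0 (is_nh_linear_l nh_NH f)).
  - by move=> f; apply: (hlinear0 (is_nh_linear_r nh_NH f)).
  - by move=> a f g; apply: hlinear_lin.
(* In arities other than 1 the functor is 0, which is homogeneous of every degree. *)
move=> n; have [congr_phi homog_phi] := phiH n; split=> [s t|ds s].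
  case: s t => [|x [|y s]] [|z [|u t]] //= _ H.
  by apply: congr_phi; apply: (H 0%N).
case: s ds => [|x [|y s]] [|d [|e ds]] //= _ H; try exact: hhomog0.
by rewrite big_seq1; apply: homog_phi; apply: (H 0%N).
Qed.
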